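(* Let the coefficients $\mu,\sigma,\beta$ and the measures $\nu_1,\dots,\nu_\ell$ satisfy the standing assumptions stated in the context, and let $H_+,H_-,H_+^*,H_-^*$ be the functions defined there. Then the two-dimensional coupled ODE $$ \begin{cases} \dot P_{+,t}=-H_+^*(t,P_{+,t},P_{-,t}),\\ \dot P_{-,t}=-H_-^*(t,P_{+,t},P_{-,t}),\\ P_{+,T}=P_{-,T}=1,\quad P_{+,t}>0,\ P_{-,t}>0,\qquad t\in[0,T], \end{cases} $$ admits a unique classical positive solution $(P_+,P_-)$. Furthermore, $$\hat v_{\pm}(t,P_{+,t},P_{-,t}):=\operatorname{argmin}_{v\in\mathbb{R}^m_+}H_{\pm}(t,v,P_{+,t},P_{-,t})$$ are bounded functions of $t$ on $[0,T]$.
   Context: Notation: $T>0$ is fixed; $m,n,\ell\ge 1$ are integers; $\mathbb{R}^m_+$ is the set of vectors in $\mathbb{R}^m$ with nonnegative components, $\mathbb{R}_+=[0,\infty)$; $x^+=\max\{x,0\}$, $x^-=\max\{-x,0\}$. $\mathcal{E}\subseteq\mathbb{R}^\ell\setminus\{0\}$ is a nonempty Borel set and $\nu_1,\dots,\nu_\ell$ are (nonnegative) Borel measures on $\mathcal{E}$ with $\sum_{j=1}^\ell\nu_j(\mathcal{E})<\infty$. Standing assumptions: the coefficients $\mu_t=(\mu_{1,t},\dots,\mu_{m,t})^\top\in\mathbb{R}^m$, $\sigma_t=(\sigma_{ik,t})\in\mathbb{R}^{m\times n}$ are deterministic, Borel-measurable and bounded on $[0,T]$; $\beta_t(e)=(\beta_{ij,t}(e))\in\mathbb{R}^{m\times\ell}$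 is deterministic, Borel-measurable and bounded on $[0,T]\times\mathcal{E}$, with $\beta_{ij}>-1$; write $\beta_{j,t}$ for the $j$-th column of $\beta_t$. There is a constant $\delta>0$ such that $$\Sigma_t:=\sigma_t\sigma_t^\top+\sum_{j=1}^\ell\int_{\mathcal{E}}\beta_{j,t}(e)\beta_{j,t}(e)^\top\nu_j(de)\ \ge\ \delta\,\mathbf{1}_m\quad\text{for all }t\in[0,T],$$ where $\mathbf{1}_m$ is the identity matrix and $\ge$ is the order of symmetric matrices. Moreover $\sum_{i=1}^m\int_0^T\mu_{i,t}\,dt>0$. For $t\in[0,T]$, $v\in\mathbb{R}^m_+$, $(P_+,P_-)\in\mathbb{R}_+\times\mathbb{R}_+$ define $$H_+(t,v,P_+,P_-)=P_+|v^\top\sigma_t|^2+2P_+v^\top\mu_t+\sum_{j=1}^\ell\int_{\mathcal{E}}\Big[P_+\big([(1+v^\top\beta_{j,t}(e))^+]^2-1-2v^\top\beta_{j,t}(e)\big)+P_-[(1+v^\top\beta_{j,t}(e))^-]^2\Big]\nu_j(de),$$ $$H_-(t,v,P_+,P_-)=P_-|v^\top\sigma_t|^2-2P_-v^\top\mu_t+\sum_{j=1}^\ell\int_{\mathcal{E}}\Big[P_-\big([(1-v^\top\beta_{j,t}(e))^+]^2-1+2v^\top\beta_{j,t}(e)\big)+P_+[(1-v^\top\beta_{j,t}(e))^-]^2\Big]\nu_j(de),$$ $$H_{\pm}^*(t,P_+,P_-)=\inf_{v\in\mathbb{R}^m_+}H_{\pm}(t,v,P_+,P_-).$$ Since the coefficients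 are only measurable in $t$, the ODE is understood for a.e. $t$: a classical solution is a pair of absolutely continuous functions on $[0,T]$ satisfying the differential equations for a.e. $t$ (equivalently, the integrated equations), together with the terminal and positivity conditions. *)

(* Defs.v *)
From HB Require Import structures.
From mathcomp Require Import all_boot all_order all_algebra.
From mathcomp Require Import all_classical all_reals all_analysis.

Set Implicit Arguments.
Unset Strict Implicit.
Unset Printing Implicit Defensive.

Import Order.TTheory GRing.Theory Num.Theory.
Import numFieldNormedType.Exports.

Local Open Scope classical_set_scope.
Local Open Scope ring_scope.

Notation borel_rV R l := (g_sigma_algebraType (@open 'rV[R]_l)).

Definition nonneg_vec (R : realType) (m : nat) : set 'cV[R]_m :=
  [set v | forall i, 0 <= v i 0].

Definition pospart (R : realType) (x : R) : R := Num.max x 0.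
Definition negpart (R : realType) (x : R) : R := Num.max (- x) 0.

Definition dotv (R : realType) (m : nat) (v w : 'cV[R]_m) : R :=
  (v^T *m w) 0 0.

Definition sqnorm (R : realType) (n : nat) (x : 'rV[R]_n) : R :=
  \sum_(k < n) x 0 k ^+ 2.

Definition sym_ge (R : realType) (m : nat) (A B : 'M[R]_m) : Prop :=
  forall x : 'cV[R]_m, (x^T *m B *m x) 0 0 <= (x^T *m A *m x) 0 0.

Definition argmin (U : Type) (R : realType) (D : set U) (f : U -> R) : set U :=
  [set v | D v /\ forall w, D w -> f v <= f w].

Definition abs_cont (R : realType) (a b : R) (f : R -> R) : Prop :=
  forall eps : R, 0 < eps -> exists2 delta : R, 0 < delta &
    forall (k : nat) (x y : 'I_k -> R),
      (forall i, a <= x i /\ x i <= y i /\ y i <= b) ->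
      trivIset setT (fun i => `]x i, y i[%classic) ->
      \sum_(i < k) (y i - x i) < delta ->
      \sum_(i < k) `|f (y i) - f (x i)| < eps.

Section Model.
Context (R : realType) (m n l : nat).
Context (E : set (borel_rV R l)).
(* A Borel measure on [E] is represented by a Borel measure on [R^l]; only its
   values on subsets of [E] are ever used. *)
Context (nu : 'I_l -> {measure set (borel_rV R l) -> \bar R}).
Context (mu : R -> 'cV[R]_m) (sigma : R -> 'M[R]_(m, n)).
Context (beta : R -> borel_rV R l -> 'M[R]_(m, l)).

Definition Sigma (t : R) : 'M[R]_m :=
  sigma t *m (sigma t)^T +
  \sum_(j < l) \matrix_(i, k)
    \int[nu j]_(e in E) (col j (beta t e) *m (col j (beta t e))^T) i k.

Definition Hplus (t : R) (v : 'cV[R]_m) (p q : R) : R :=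
  p * sqnorm (v^T *m sigma t) + 2 * p * dotv v (mu t) +
  \sum_(j < l) \int[nu j]_(e in E)
    (let b := dotv v (col j (beta t e)) in
     p * (pospart (1 + b) ^+ 2 - 1 - 2 * b) + q * negpart (1 + b) ^+ 2).

Definition Hminus (t : R) (v : 'cV[R]_m) (p q : R) : R :=
  q * sqnorm (v^T *m sigma t) - 2 * q * dotv v (mu t) +
  \sum_(j < l) \int[nu j]_(e in E)
    (let b := dotv v (col j (beta t e)) in
     q * (pospart (1 - b) ^+ 2 - 1 + 2 * b) + p * negpart (1 - b) ^+ 2).

(* [inf] is the real-valued infimum, equal to [0] on sets that are not bounded
   below; for [p, q > 0], the only case used in the equation, the sets below
   are bounded below under [standing_assumptions]. *)
Definition Hplus_star (t p q : R) : R :=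
  inf [set Hplus t v p q | v in @nonneg_vec R m].

Definition Hminus_star (t p q : R) : R :=
  inf [set Hminus t v p q | v in @nonneg_vec R m].

Definition standing_assumptions (T : R) : Prop :=
  [/\ [/\ 0 < T, (0 < m)%N, (0 < n)%N & (0 < l)%N],
      [/\ measurable E, E !=set0, ~ E (0 : 'rV[R]_l) &
          (\sum_(j < l) nu j E < +oo)%E],
      [/\ (forall i, measurable_fun `[0, T]%classic (fun t => mu t i 0)),
          (forall i, [bounded mu t i 0 | t in `[0, T]%classic]),
          (forall i k, measurable_fun `[0, T]%classic (fun t => sigma t i k)) &
          (forall i k, [bounded sigma t i k | t in `[0, T]%classic])],
      [/\ (forall i j, measurable_fun (`[0, T]%classic `*` E)
                         (fun x : R * borel_rV R l => beta x.1 x.2 i j)),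
          (forall i j, [bounded beta x.1 x.2 i j | x in `[0, T]%classic `*` E]) &
          (forall i j t e, t \in `[0, T] -> E e -> -1 < beta t e i j)] &
      (exists2 delta : R, 0 < delta &
         forall t, t \in `[0, T] -> sym_ge (Sigma t) (delta%:M)) /\
      0 < \sum_(i < m) \int[@lebesgue_measure R]_(t in `[0, T]) mu t i 0].

Definition positive_solution (T : R) (P : (R -> R) * (R -> R)) : Prop :=
  [/\ abs_cont 0 T P.1 /\ abs_cont 0 T P.2,
      {ae @lebesgue_measure R, forall t, t \in `[0, T] ->
         is_derive t 1 P.1 (- Hplus_star t (P.1 t) (P.2 t))},
      {ae @lebesgue_measure R, forall t, t \in `[0, T] ->
         is_derive t 1 P.2 (- Hminus_star t (P.1 t) (P.2 t))},
      P.1 T = 1 /\ P.2 T = 1 &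
      forall t, t \in `[0, T] -> 0 < P.1 t /\ 0 < P.2 t].

End Model.

(* Main.v *)
(* Write [Hplus t v p q = p * A t v + q * B t v], where the jump integrands of [A]
   and [B] are nonnegative convex functions of [v^T beta] that sum to its square.
   Since [Sigma t >= delta], [Hplus] is coercive and strongly convex with modulus
   [min p q * delta]. Hence for [p, q > 0] it has a unique minimizer over the
   orthant, bounded as long as [p, q] stay in an interval [[c, 1]]; there
   [Hplus_star] is bounded and Lipschitz in [(p, q)], and it is measurable in [t]
   as an infimum over a countable dense set. Moreover [Hplus_star <= 0], and
   [Hplus_star >= - C * p] when [p <= q]: every positive solution is nondecreasing
   in [t], and its smaller component is at least [exp (- C * (T - t))]. So all
   positive solutions live in [[c, 1]] with [c = exp (- C * T)], and cutting the
   arguments off at [c] and [1] gives a globally Lipschitz equation, solved by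
   Picard iteration. Both the a priori bounds and uniqueness (Gronwall) rest on
   one fact: an absolutely continuous function whose derivative is nonnegative
   almost everywhere is nondecreasing. *)
Require Import Defs.
From HB Require Import structures.
From mathcomp Require Import all_boot all_order all_algebra.
From mathcomp Require Import all_classical all_reals all_analysis.
From mathcomp Require Import measurable_realfun ring lra.
Import Order.TTheory GRing.Theory Num.Theory.
Import numFieldNormedType.Exports.
Local Open Scope classical_set_scope.
Local Open Scope ring_scope.
Set Implicit Arguments.
Unset Strict Implicit.
Unset Printing Implicit Defensive.

(** * Absolutely continuous functions *)

(** Completing the square in [min p q * del * r ^ 2 - 2 * p * K * r] gives the lower bound
    [- p ^ 2 * K ^ 2 / (min p q * del)], which is linear in [p] only when [p] is the smaller
    argument. This estimate therefore bounds neither component on its own: the comparison has to be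
    run on their minimum, which may fail to be differentiable where the components cross. Hence
    monotonicity is proved from a one-sided condition that passes to maxima, rather than from the
    sign of a derivative. The exceptional null set is paid for by absolute continuity, inside an
    open cover of small measure. The same monotonicity principle yields the contraction estimate for
    the Picard map, where a weight [exp (4 * L * (T - t))] makes the map contract on all of [[0, T]]
    at once, without subdividing the interval. *)

(** A lower derivative that is nonnegative at [x], in straddle form: only intervals containing [x]
    are tested, with a gauge [d] as in Cousin's lemma. *)
Definition almost_nondecreasing_at (R : realType) (a b : R) (f : R -> R) (x : R)
  := forall eps : R, 0 < eps -> exists2 d : R, 0 < d &
    forall y z, a <= y -> z <= b -> x - d < y -> y <= x -> x <= z -> z < x + d ->
      - eps * (z - y) <= f z - f y.

Section AbsoluteContinuity.
Context (R : realType).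
Implicit Types (a b : R) (f g : R -> R).
Notation leb := (@lebesgue_measure R).

Lemma abs_contW a b c d f : a <= c -> d <= b -> abs_cont a b f -> abs_cont c d f.
Proof.
move=> ac db acf e e0; have [r r0 H] := acf e e0; exists r => // k x y xy.
apply: H => i; have [cx [xy' yd]] := xy i.
by split; [exact: le_trans cx | split => //; exact: le_trans db].
Qed.

Lemma sum_lengths_le (k : nat) (x y : 'I_k -> R) (U : set R) :
  measurable U -> (forall i, x i <= y i) ->
  trivIset setT (fun i : 'I_k => `]x i, y i[%classic) ->
  (forall i, `]x i, y i[%classic `<=` U) ->
  ((\sum_(i < k) (y i - x i))%:E <= leb U)%E.
Proof.
move=> mU xy tI sub.
have -> : ((\sum_(i < k) (y i - x i))%:E
           = \sum_(i < k) leb `]x i, y i[%classic)%E.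
  rewrite -sumEFin; apply: eq_bigr => i _.
  rewrite lebesgue_measure_itv/= lte_fin.
  have := xy i; rewrite le_eqVlt => /predU1P[->|->//].
  by rewrite ltxx subrr.
rewrite -measure_bigsetU_ord//.
apply: le_measure; rewrite ?inE//.
  by apply: bigsetU_measurable => i _; exact: measurable_itv.
by elim/big_ind : _ => // A B AU BU z [/AU|/BU].
Qed.

(* Cousin's argument: the good points have a gauge from the local estimate, the
   bad ones lie in an open set [U] of small measure; the increment of [f] over
   the intervals tagged by bad points is controlled by absolute continuity. *)
Lemma abs_cont_le a b f : a <= b -> abs_cont a b f ->
  {ae leb, forall x, x \in `[a, b] -> almost_nondecreasing_at a b f x} ->
  f a <= f b.
Proof.
move=> ab acf [N [mN N0 badN]].
(* [e * (b - a)] is the loss over steps through good points, the extra [e] the loss over the bad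
   ones. The value of [e] chosen for the contradiction makes their sum half of the assumed drop
   [f a - f b]. *)
suff key (e : R) : 0 < e -> - e * (b - a) - e <= f b - f a.
  rewrite -subr_ge0 leNgt; apply/negP => fba.
  pose e := (f a - f b) / (2 * (b - a + 1)).
  have ba1 : 0 < 2 * (b - a + 1) by lra.
  have e0 : 0 < e by rewrite divr_gt0//; lra.
  have ee : e * (2 * (b - a + 1)) = f a - f b.
    by rewrite /e divfK// gt_eqF.
  by have := key e e0; nra.
move=> e0; have [r r0 Hr] := acf e e0.
have [U [oU NU Ur]] : exists U, [/\ open U, N `<=` U & (leb U < r%:E)%E].
  have [|U [oU NU Ur]] := lebesgue_regularity_outer mN _ r0.
    by rewrite [ltLHS]N0 ltry.
  exists U; split => //; rewrite -(setDUK NU).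
  have mUN : measurable (U `\` N).
    by apply: measurableD => //; exact: open_measurable.
  by rewrite (le_lt_trans (measureU2 _ mN mUN))// [X in (X + _)%E]N0 add0e.
pose fam c := exists k (x y : nat -> R),
  [/\ forall i, (i < k)%N -> [/\ a <= x i, x i <= y i & y i <= c],
      forall i j, (i < j)%N -> (j < k)%N -> y i <= x j,
      forall i, (i < k)%N -> `]x i, y i[%classic `<=` U &
      - e * (c - a) - \sum_(i < k) `|f (y i) - f (x i)| <= f c - f a].
have fam_good c z : fam c -> c <= z -> - e * (z - c) <= f z - f c -> fam z.
  move=> [k [x [y [H1 H2 H3 H4]]]] cz H; exists k, x, y; split => //; last lra.
  by move=> i /H1[? ? ?]; split => //; exact: le_trans cz.
have fam_bad c z : a <= c -> fam c -> c <= z -> `]c, z[%classic `<=` U -> fam z.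
  move=> ac [k [x [y [H1 H2 H3 H4]]]] cz H.
  exists k.+1, (fun i => if i == k then c else x i),
    (fun i => if i == k then z else y i); split.
  - move=> i; rewrite ltnS leq_eqVlt; case: eqP => [//|_ /= /H1[? ? ?]].
    by split => //; exact: le_trans cz.
  - move=> i j ij; rewrite ltnS leq_eqVlt => /predU1P[jk|jk].
      rewrite jk eqxx ltn_eqF -?jk//; move: ij; rewrite jk => /H1[_ _].
      by move=> /le_trans; apply.
    rewrite ltn_eqF ?(ltn_trans ij)// ltn_eqF//; exact: H2.
  - by move=> i; rewrite ltnS leq_eqVlt; case: eqP => //= _ /H3.
  rewrite big_ord_recr/= eqxx.
  under eq_bigr => i _ do rewrite ltn_eqF ?ltn_ord//.
  have := ler_norm (f c - f z); rewrite distrC.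
  have : 0 <= e * (z - c) by apply: mulr_ge0; [exact: ltW|rewrite subr_ge0].
  by move: (\sum_(i < k) _) H4 => S; move: `|_| => W; lra.
pose S : set R := [set c | [/\ a <= c, c <= b & fam c]].
have Sa : S a.
  split => //; exists 0%N, (fun=> 0), (fun=> 0); split => //.
  by rewrite big_ord0; lra.
have ubS : ubound S b by move=> c [].
have hsS : has_sup S by split; [exists a|exists b].
set s := sup S.
have as_ : a <= s by exact: (ub_le_sup hsS.2).
have sb : s <= b by apply: ge_sup => //; exists a.
(* If [s] is in [U], so is an interval around it, and the step across [s] is appended to the list;
   otherwise [s] is good and its gauge allows the step without a new interval. In both cases
   [[c, z]] straddles [s]. *)
have step : exists2 d, 0 < d &
    forall c z, S c -> s - d < c -> c <= s -> s <= z -> z < s + d -> z <= b -> S z.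
  have [Us|Us] := pselect (U s).
    have /nbhs_ballP[d d0 dU] : nbhs s U by exact: open_nbhs_nbhs.
    exists d => // c z [ac _ fc] sdc cs sz zsd zb.
    have cz : c <= z by exact: le_trans sz.
    split => //; first exact: le_trans cz.
    apply: fam_bad fc cz _ => // w /=; rewrite in_itv/= => /andP[cw wz].
    apply: dU; rewrite ball_itv/= in_itv/=; lra.
  have good : almost_nondecreasing_at a b f s.
    apply: contrapT => H; apply/Us/NU/badN => /= /(_ _)/H; apply.
    by rewrite in_itv/= as_.
  have [d d0 dP] := good _ e0; exists d => // c z [ac _ fc] sdc cs sz zsd zb.
  have cz : c <= z by exact: le_trans sz.
  split => //; first exact: le_trans cz.
  by apply: fam_good fc cz _ => //; exact: dP.
have [d d0 dS] := step.
have [c Sc sdc] := sup_adherent d0 hsS; rewrite -/s in sdc.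
have cs : c <= s by exact: (ub_le_sup hsS.2).
have : S b.
  have [->|sneb] := eqVneq b s; first by apply: (dS c) => //; lra.
  exfalso; have slb : s < b by rewrite lt_neqAle sb eq_sym sneb.
  pose z := Num.min b (s + d / 2).
  have zb : z <= b by rewrite ge_min lexx.
  have sz : s < z by rewrite lt_min slb ltrDl divr_gt0.
  have zsd : z < s + d by rewrite gt_min; apply/orP; right; lra.
  have : z <= s by apply: (ub_le_sup hsS.2); apply: (dS c) => //; exact: ltW.
  by rewrite leNgt sz.
move=> [_ _ [k [x [y [H1 H2 H3 H4]]]]].
pose x' (i : 'I_k) := x i; pose y' (i : 'I_k) := y i.
have tI : trivIset setT (fun i : 'I_k => `]x' i, y' i[%classic).
  apply/trivIsetP => i j _ _ ij; rewrite -subset0 => w [] /=.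
  rewrite !in_itv/= => /andP[xiw wyi] /andP[xjw wyj].
  move: ij; rewrite neq_ltn => /orP[ij|ij].
    by have := H2 _ _ ij (ltn_ord j); rewrite /x' /y' in xiw wyi xjw wyj *; lra.
  by have := H2 _ _ ij (ltn_ord i); rewrite /x' /y' in xiw wyi xjw wyj *; lra.
(* The list lies in [U], whose measure is below [r], so the increments over it sum to less than
   [e]. *)
have := Hr k x' y' (fun i => let: And3 p q r := H1 i (ltn_ord i) in
  conj p (conj q r)) tI.
move=> /(_ _)/wrap[|].
  rewrite -lte_fin (le_lt_trans _ Ur)//; apply: sum_lengths_le => //.
  - exact: open_measurable.
  - by move=> i; have [] := H1 i (ltn_ord i).
  - by move=> i; exact: H3.
rewrite /x' /y' => Hs; lra.
Qed.

(** Serves for maxima, differences and products with exponentials: their increments are dominated by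
    those of two absolutely continuous functions and by the length. Each of the three sums receives
    [e / (3 * K)]. *)
Lemma abs_cont_lip2 a b (K : R) f g h : 0 < K -> abs_cont a b f -> abs_cont a b g ->
  (forall x y, a <= x -> x <= y -> y <= b ->
     `|h y - h x| <= K * (`|f y - f x| + `|g y - g x| + (y - x))) ->
  abs_cont a b h.
Proof.
move=> K0 acf acg hK e e0.
have e3 : 0 < e / (3 * K) by rewrite divr_gt0// mulr_gt0.
have [rf rf0 Hf] := acf _ e3; have [rg rg0 Hg] := acg _ e3.
exists (Num.min (Num.min rf rg) (e / (3 * K))).
  by rewrite !lt_min rf0 rg0.
move=> k x y xy tI; rewrite !lt_min -andbA => /and3P[lf lg le].
have := Hf k x y xy tI lf; have := Hg k x y xy tI lg.
move=> Hg' Hf'.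
have -> : e = K * (e / (3 * K) + e / (3 * K) + e / (3 * K)).
  by field; rewrite gt_eqF.
apply: le_lt_trans (_ : K * (\sum_(i < k) `|f (y i) - f (x i)|
  + \sum_(i < k) `|g (y i) - g (x i)| + \sum_(i < k) (y i - x i)) < _).
  rewrite -!big_split/= mulr_sumr; apply: ler_sum => i _.
  by have [? [? ?]] := xy i; exact: hK.
by rewrite ltr_pM2l//; lra.
Qed.

Lemma lipschitz_abs_cont a b (K : R) f : 0 < K ->
  (forall x y, a <= x -> x <= y -> y <= b -> `|f y - f x| <= K * (y - x)) ->
  abs_cont a b f.
Proof.
move=> K0 fK e e0; exists (e / K); first exact: divr_gt0.
move=> k x y xy tI; rewrite ltr_pdivlMr// mulrC => /(le_lt_trans _); apply.
rewrite mulr_sumr; apply: ler_sum => i _.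
by have [? [? ?]] := xy i; exact: fK.
Qed.

End AbsoluteContinuity.

(** * From derivatives to the straddle condition, and its stability under maxima *)

Section Derivatives.
Context (R : realType).
Implicit Types (a b x : R) (f g : R -> R).

Lemma is_derive_incr (f : R -> R) (x df : R) : is_derive x 1 f df ->
  forall eps, 0 < eps -> exists2 d : R, 0 < d &
    forall y, `|y - x| < d -> `|f y - f x - df * (y - x)| <= eps * `|y - x|.
Proof.
move=> [dfx <-] e e0.
have /cvgrPdist_le/(_ e e0)/nbhs_ballP[d/= d0 H] := dfx.
exists d => // y yx.
have [->|yx0] := eqVneq y x; first by rewrite !subrr mulr0 subrr !normr0 mulr0.
have yxn : y - x != 0 by rewrite subr_eq0.
have := H (y - x); rewrite /ball/= sub0r normrN => /(_ yx yxn).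
rewrite {1}/GRing.scale/= [_%:A]mulr1 subrK => {}H.
have -> : f y - f x - 'D_1 f x * (y - x)
   = - (('D_1 f x - (y - x)^-1 *: (f y - f x)) * (y - x)).
  by rewrite /GRing.scale/=; field.
by rewrite normrN normrM ler_pM2r// normr_gt0.
Qed.

(** The first-order expansions at [y] and [z] have errors [e * (x - y)] and [e * (z - x)], which add
    up to [e * (z - y)] because [x] lies between them. *)
Lemma derive_ge0_almost_nondecreasing a b f x df :
  is_derive x 1 f df -> 0 <= df -> almost_nondecreasing_at a b f x.
Proof.
move=> fdf df0 e e0; have [d d0 H] := is_derive_incr fdf e0.
exists d => // y z _ _ xdy yx xz zxd.
have := H y; rewrite ler0_norm ?subr_le0// => /(_ _)/wrap[|Hy]; first lra.
have := H z; rewrite (ger0_norm (_ : 0 <= z - x)) ?subr_ge0//.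
move=> /(_ _)/wrap[|Hz]; first lra.
have := ler_norm (f y - f x - df * (y - x)).
have := ler_norm (- (f z - f x - df * (z - x))); rewrite normrN => Az Ay.
have : 0 <= df * (z - y) by rewrite mulr_ge0//; lra.
by nra.
Qed.

(** Only the functions attaining the maximum at [x] matter. If one is strictly larger, continuity
    makes it the maximum near [x]. At a tie, [f] alone bounds the maximum from below at [z], and
    both functions bound it from above at [y], all relative to the common value at [x]. *)
Lemma almost_nondecreasing_max a b f g x :
  a <= x -> x <= b ->
  {for x, continuous f} -> {for x, continuous g} ->
  (g x <= f x -> almost_nondecreasing_at a b f x) ->
  (f x <= g x -> almost_nondecreasing_at a b g x) ->
  almost_nondecreasing_at a b (fun t => Num.max (f t) (g t)) x.
Proof.
wlog fg : f g / g x <= f x.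
  move=> H ax xb cf cg nf ng; have [fg|gf] := leP (g x) (f x); first exact: H.
  have := H g f (ltW gf) ax xb cg cf ng nf.
  by under eq_fun do rewrite maxC.
move=> ax xb cf cg /(_ fg) nf ng e e0; have [d d0 df] := nf e e0.
move: fg; rewrite le_eqVlt => /predU1P[fgE|gf].
  have [|d' d'0 dg] := ng _ e e0; first by rewrite fgE.
  exists (Num.min d d'); first by rewrite lt_min d0.
  move=> y z ay zb + yx xz; rewrite ltrBlDr -ltrBlDl lt_min => /andP[xy xy'].
  rewrite -ltrBlDl lt_min => /andP[zx zx'].
  have fz : f x - e * (z - x) <= f z by have := df x z; lra.
  have fy : f y <= f x + e * (x - y) by have := df y x; lra.
  have gy : g y <= f x + e * (x - y) by have := dg y x; lra.
  have : f z <= Num.max (f z) (g z) by rewrite le_max lexx.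
  have : Num.max (f y) (g y) <= f x + e * (x - y) by rewrite ge_max fy gy.
  by move: (Num.max _ _) (Num.max _ _) => M1 M2; lra.
pose r := (f x - g x) / 2.
have r0 : 0 < r by rewrite divr_gt0// subr_gt0.
move/cvgrPdist_lt : cf => /(_ r r0)/nbhs_ballP[d1/= d10 cf].
move/cvgrPdist_lt : cg => /(_ r r0)/nbhs_ballP[d2/= d20 cg].
have fgt t : `|x - t| < d1 -> `|x - t| < d2 -> Num.max (f t) (g t) = f t.
  move=> /cf A /cg B; apply/max_idPl; move: A B.
  by rewrite /r !ltr_norml => /andP[? ?] /andP[? ?]; lra.
exists (Num.min d (Num.min d1 d2)); first by rewrite !lt_min d0 d10.
move=> y z ay zb + yx xz.
rewrite ltrBlDr -ltrBlDl !lt_min => /and3P[xy xy1 xy2].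
rewrite -ltrBlDl !lt_min => /and3P[zx zx1 zx2].
rewrite (fgt y) ?ger0_norm ?subr_ge0//.
rewrite (fgt z) ?ler0_norm ?subr_le0 ?opprB//.
by apply: df => //; lra.
Qed.

Lemma almost_nondecreasing_cst a b (k x : R) :
  almost_nondecreasing_at a b (fun=> k) x.
Proof.
move=> e e0; exists 1 => // y z _ _ _ yx xz _.
by rewrite subrr mulNr oppr_le0 mulr_ge0 ?(ltW e0)// subr_ge0 (le_trans yx).
Qed.

End Derivatives.

(** * A priori lower bound and uniqueness for backward equations *)

Section Comparison.
Context (R : realType) (T : R).
Notation leb := (@lebesgue_measure R).

Lemma ae_impl (P Q : R -> Prop) : (forall x, P x -> Q x) ->
  {ae leb, forall x, P x} -> {ae leb, forall x, Q x}.
Proof.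
by move=> PQ; apply: filterS; first exact: (ae_filter_ringOfSetsType leb).
Qed.

Lemma ae_and (P Q : R -> Prop) : {ae leb, forall x, P x} ->
  {ae leb, forall x, Q x} -> {ae leb, forall x, P x /\ Q x}.
Proof.
move=> aP aQ; have := @filterI _ _ (ae_filter_ringOfSetsType leb) _ _ aP aQ.
exact: ae_impl.
Qed.

Lemma is_derive_continuous (f : R -> R) (x df : R) :
  is_derive x 1 f df -> {for x, continuous f}.
Proof. by case=> fx _; exact/differentiable_continuous/derivable1_diffP. Qed.

Lemma is_derive_expR_affine (k c x : R) :
  is_derive x 1 (fun t => expR (k * t + c)) (k * expR (k * x + c)).
Proof.
have kc : is_derive x 1 (fun t : R => k * t + c) k.
  have := is_deriveD (is_deriveZ k (is_derive_id x 1)) (is_derive_cst c x 1).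
  by rewrite addr0 /GRing.scale/= mulr1.
by have := is_derive1_comp (is_derive_expR _) kc; rewrite mulrC.
Qed.

(** By convexity the slope at the right end dominates; concretely, [exp (- u) >= 1 - u] with
    [u = k * (y - x)]. *)
Lemma expR_affine_lip (k c x y : R) : 0 <= k -> x <= y ->
  `|expR (k * y + c) - expR (k * x + c)| <= k * expR (k * y + c) * (y - x).
Proof.
move=> k0 xy; have kxy : 0 <= k * (y - x) by rewrite mulr_ge0// subr_ge0.
rewrite ger0_norm; last by rewrite subr_ge0 ler_expR; nra.
have -> : k * x + c = (k * y + c) - k * (y - x) by ring.
rewrite [X in _ - X]expRD.
have := expR_ge1Dx (- (k * (y - x))); have := expR_gt0 (k * y + c).
by move: (expR _) (expR _) => u v; nra.
Qed.

Lemma ler_norm_max (a b c d : R) :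
  `|Num.max a b - Num.max c d| <= `|a - c| + `|b - d|.
Proof.
have Ha := ler_norm (a - c); have Hb := ler_norm (b - d).
have Ha' := ler_norm (c - a); have Hb' := ler_norm (d - b).
rewrite distrC in Ha'; rewrite distrC in Hb'.
have Pa := normr_ge0 (a - c); have Pb := normr_ge0 (b - d).
by have [ab|ba] := leP a b; have [cd|dc] := leP c d; rewrite ler_norml;
  apply/andP; split; lra.
Qed.

Lemma abs_cont_ge0_derive_le (f f' : R -> R) (s t : R) : 0 <= s -> s <= t -> t <= T ->
  abs_cont 0 T f ->
  {ae leb, forall t, t \in `[0, T] -> is_derive t 1 f (f' t)} ->
  (forall t, t \in `[0, T] -> 0 <= f' t) -> f s <= f t.
Proof.
move=> s0 st tT acf df f'0; apply: abs_cont_le => //; first exact: abs_contW acf.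
apply: ae_impl df => x df; rewrite in_itv/= => /andP[sx xt].
have x0T : x \in `[0, T] by rewrite in_itv/=; lra.
exact: derive_ge0_almost_nondecreasing (df x0T) (f'0 _ x0T).
Qed.

(* The positive part [V] of [expR (C * (t - T)) - min (X true) (X false)] is
   nondecreasing, and vanishes at [T]. *)
Lemma decay_lower_bound (C : R) (X X' : bool -> R -> R) : 0 < C ->
  (forall b, abs_cont 0 T (X b)) ->
  (forall b, {ae leb, forall t, t \in `[0, T] -> is_derive t 1 (X b) (X' b t)}) ->
  (forall b, X b T = 1) ->
  (forall b t, t \in `[0, T] -> X b t <= X (~~ b) t ->
     X b t <= expR (C * (t - T)) -> X' b t <= C * expR (C * (t - T))) ->
  forall b t, t \in `[0, T] -> expR (C * (t - T)) <= X b t.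
Proof.
move=> C0 acX dX XT HX b t tT; have := tT; rewrite in_itv/= => /andP[t0 tleT].
pose e t : R := expR (C * t + - C * T).
have eE s : expR (C * (s - T)) = e s by rewrite /e; congr expR; ring.
pose v b t := e t - X b t.
pose V t := Num.max (Num.max (v true t) (v false t)) 0.
have vV b' s : v b' s <= V s by rewrite /V 2!le_max; case: b'; rewrite lexx ?orbT.
suff : V t <= V T.
  rewrite /V/v !XT /e -mulrDl subrr mul0r expR0 subrr !maxxx -/(V t) => VT.
  rewrite eE; have := vV b t; rewrite /v; lra.
have Vlip : abs_cont 0 T V.
  apply: (@abs_cont_lip2 _ 0 T (2 * C + 2) (X true) (X false)) => //; first lra.
  move=> x y x0 xy yT; apply: le_trans (ler_norm_max _ _ _ _) _.
  rewrite subrr normr0 addr0; apply: le_trans (ler_norm_max _ _ _ _) _.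
  have exy : `|e y - e x| <= C * (y - x).
    apply: le_trans (expR_affine_lip _ _ xy) _; first exact: ltW.
    rewrite ler_wpM2r ?subr_ge0// ler_piMr ?(ltW C0)//.
    by rewrite -[leRHS]expR0 ler_expR; nra.
  have vxy b' : `|v b' y - v b' x| <= C * (y - x) + `|X b' y - X b' x|.
    rewrite /v; have -> : e y - X b' y - (e x - X b' x)
      = (e y - e x) - (X b' y - X b' x) by ring.
    by apply: le_trans (ler_normB _ _) _; rewrite lerD2r.
  have := lerD (vxy true) (vxy false).
  move/le_trans; apply.
  have Pa := normr_ge0 (X true y - X true x).
  have Pb := normr_ge0 (X false y - X false x).
  nra.
apply: abs_cont_le => //; first exact: abs_contW Vlip.
have := ae_and (dX true) (dX false); apply: ae_impl => x [dt df].
rewrite in_itv/= => /andP[tx xT].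
have x0T : x \in `[0, T] by rewrite in_itv/= xT (le_trans t0).
have dv b' : is_derive x 1 (v b') (C * e x - X' b' x).
  apply: is_deriveB; first exact: is_derive_expR_affine.
  by case: b'; [exact: dt|exact: df].
(* Where [v b'] is nonnegative and the larger of the two, [X b'] is the smaller component and lies
   below the exponential: exactly the case covered by [HX]. *)
have nv b' : 0 <= v b' x -> v (~~ b') x <= v b' x ->
    almost_nondecreasing_at t T (v b') x.
  move=> v0 vv; apply: derive_ge0_almost_nondecreasing (dv b') _.
  rewrite subr_ge0 -eE; apply: HX => //; rewrite ?eE; move: v0 vv; rewrite /v; lra.
apply: almost_nondecreasing_max => //.
- by apply: continuous_max; exact: is_derive_continuous (dv _).
- exact: cst_continuous.
- move=> m0; apply: almost_nondecreasing_max => //.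
  + exact: is_derive_continuous (dv _).
  + exact: is_derive_continuous (dv _).
  + by move=> ft; apply: (nv true) => //; move: m0; rewrite (max_idPl ft).
  + by move=> tf; apply: (nv false) => //; move: m0; rewrite (max_idPr tf).
- by move=> _; exact: almost_nondecreasing_cst.
Qed.

(* Gronwall: [expR (4 * K * t) * (d true t ^+ 2 + d false t ^+ 2)] is
   nondecreasing, and vanishes at [T]. *)
Lemma backward_uniqueness (K : R) (d d' : bool -> R -> R) : 0 < K ->
  (forall b, abs_cont 0 T (d b)) ->
  (forall b, {ae leb, forall t, t \in `[0, T] -> is_derive t 1 (d b) (d' b t)}) ->
  (forall b t, t \in `[0, T] -> `|d b t| <= 1) ->
  (forall b t, t \in `[0, T] ->
     `|d' b t| <= K * (`|d true t| + `|d false t|)) ->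
  (forall b, d b T = 0) ->
  forall b t, t \in `[0, T] -> d b t = 0.
Proof.
move=> K0 acd dd d1 d'K dT b t tT; have := tT; rewrite in_itv/= => /andP[t0 tleT].
pose e t : R := expR (4 * K * t + 0).
pose D t := d true t ^+ 2 + d false t ^+ 2.
have K4 : 0 < 4 * K by lra.
have D2 s : s \in `[0, T] -> 0 <= D s <= 2.
  move=> sT; have := d1 true s sT; have := d1 false s sT.
  rewrite /D -(real_normK (num_real (d true s))) -(real_normK (num_real (d false s))).
  have := normr_ge0 (d true s); have := normr_ge0 (d false s); nra.
have e_gt0 s : 0 < e s by exact: expR_gt0.
suff : e t * D t <= e T * D T.
  rewrite [in leRHS]/D !dT expr0n/= addr0 mulr0 pmulr_rle0// /D.
  by move=> D0; apply/eqP; rewrite -sqrf_eq0 eq_le sqr_ge0 andbT; case: b;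
    apply: le_trans D0; rewrite ?lerDl ?lerDr sqr_ge0.
(* The bound by [1] on [d] makes squaring Lipschitz with constant [2] and gives [D <= 2]. *)
have acE : abs_cont 0 T (fun s => e s * D s).
  apply: (@abs_cont_lip2 _ 0 T (e T * (2 + 4 * K * 2)) (d true) (d false)) => //.
    by rewrite mulr_gt0//; lra.
  move=> x y x0 xy yT.
  have xT : x \in `[0, T] by rewrite in_itv/= x0 (le_trans xy).
  have yT' : y \in `[0, T] by rewrite in_itv/= yT (le_trans x0).
  have exy : `|e y - e x| <= 4 * K * e T * (y - x).
    apply: le_trans (expR_affine_lip _ _ xy) _; first exact: ltW.
    rewrite ler_wpM2r ?subr_ge0// ler_wpM2l ?(ltW K4)//.
    by rewrite ler_expR lerD2r ler_wpM2l ?(ltW K4).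
  have sq b' : `|d b' y ^+ 2 - d b' x ^+ 2| <= 2 * `|d b' y - d b' x|.
    rewrite subr_sqr normrM mulrC ler_wpM2r//.
    by apply: le_trans (ler_normD _ _) _; have := d1 b' _ xT; have := d1 b' _ yT'; lra.
  have Dxy : `|D y - D x| <= 2 * (`|d true y - d true x| + `|d false y - d false x|).
    rewrite /D opprD addrACA mulrDr.
    by apply: le_trans (ler_normD _ _) _; exact: lerD.
  have -> : e y * D y - e x * D x = e y * (D y - D x) + (e y - e x) * D x by ring.
  apply: le_trans (ler_normD _ _) _; rewrite !normrM (gtr0_norm (e_gt0 y)).
  have /andP[Dx0 Dx2] := D2 _ xT; rewrite (ger0_norm Dx0).
  have eyT : e y <= e T by rewrite ler_expR lerD2r ler_wpM2l ?(ltW K4).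
  apply: le_trans (_ : e T * (2 * (`|d true y - d true x| + `|d false y - d false x|))
                   + (4 * K * e T * (y - x)) * 2 <= _).
    by apply: lerD; apply: ler_pM => //; exact: ltW.
  have Pa := normr_ge0 (d true y - d true x).
  have Pb := normr_ge0 (d false y - d false x).
  have eT := e_gt0 T; rewrite -subr_ge0.
  move: `|d true y - d true x| `|d false y - d false x| Pa Pb => P Q P0 Q0.
  have -> : e T * (2 + 4 * K * 2) * (P + Q + (y - x)) -
     (e T * (2 * (P + Q)) + 4 * K * e T * (y - x) * 2)
    = e T * (8 * K * (P + Q) + 2 * (y - x)) by ring.
  by rewrite mulr_ge0 ?(ltW eT)// addr_ge0// mulr_ge0//; lra.
apply: (@abs_cont_le _ t T (fun s => e s * D s)) => //.
  exact: abs_contW acE.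
have := ae_and (dd true) (dd false); apply: ae_impl => x [dt df].
rewrite in_itv/= => /andP[tx xT].
have x0T : x \in `[0, T] by rewrite in_itv/= xT (le_trans t0).
have := is_deriveM (is_derive_expR_affine (4 * K) 0 x)
  (is_deriveD (is_deriveX 2 (dt x0T)) (is_deriveX 2 (df x0T))).
move/derive_ge0_almost_nondecreasing; apply.
have prod_ge b' : - (`|d b' x| * (K * (`|d true x| + `|d false x|)))
    <= d b' x * d' b' x.
  rewrite lerNl; apply: le_trans (ler_norm _) _.
  by rewrite normrN normrM ler_wpM2l//; exact: d'K.
have := prod_ge true; have := prod_ge false.
rewrite /GRing.scale/= -/(e x) !fctE !expr1.
have : `|d true x| ^+ 2 = d true x ^+ 2 by rewrite real_normK// num_real.
have : `|d false x| ^+ 2 = d false x ^+ 2 by rewrite real_normK// num_real.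
move: (d true x) (d false x) (d' true x) (d' false x).
move=> a c a' c' wc ua cc aa.
rewrite [X in 0 <= X](_ : _ = e x * (2 * (a * a') + 2 * (c * c')
  + 4 * K * (a ^+ 2 + c ^+ 2))); last ring.
rewrite mulr_ge0 ?(ltW (e_gt0 x))// -wc -ua.
(* Equivalent to [(|a| + |c|) ^ 2 <= 2 * (a ^ 2 + c ^ 2)] up to the factor [K]; this is what makes
   the rate [4 * K] large enough. *)
have : 0 <= K * (`|a| - `|c|) ^+ 2 by rewrite mulr_ge0 ?sqr_ge0// ltW.
nra.
Qed.

End Comparison.

(** * Lebesgue primitives and Picard iteration *)

Section Primitive.
Context (R : realType).
Notation leb := (@lebesgue_measure R).

Lemma lebesgue_measure_itv_lty (c d : bool) (a b : R) :
  (leb [set` Interval (BSide c a) (BSide d b)] < +oo)%E.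
Proof.
rewrite lebesgue_measure_itv/=; case: ifP => _; last by rewrite ltry.
by rewrite -EFinD ltry.
Qed.

Lemma bounded_near_cst (V : normedModType R) (T : Type) (D : set T) (f : T -> V)
    (M : R) :
  (forall x, D x -> `|f x| <= M) -> [bounded f x | x in D].
Proof.
move=> fM; exists M; split; first exact: num_real.
by move=> N MN x /= Dx; apply: le_trans (ltW MN); exact: fM.
Qed.

Lemma lip_continuous (f : R -> R) (M : R) : 0 < M ->
  (forall x y, x <= y -> `|f y - f x| <= M * (y - x)) -> continuous f.
Proof.
move=> M0 fM x; apply/cvgrPdist_lt => e e0; near=> y.
apply: (@le_lt_trans _ _ (M * `|x - y|)); last first.
  rewrite -ltr_pdivlMl//; near: y; apply: cvgr_dist_lt => //.
  by rewrite mulr_gt0// invr_gt0.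
have [xy|yx] := leP x y.
  rewrite distrC [`|x - y|]distrC (ger0_norm (_ : 0 <= y - x)) ?subr_ge0//.
  exact: fM.
by rewrite (ger0_norm (_ : 0 <= x - y)) ?subr_ge0 ?(ltW yx)//; apply/fM/ltW.
Unshelve. all: by end_near. Qed.

(** The integrands will be extended by zero outside [[0, T]]; starting at [-oo] then gives a
    primitive that is Lipschitz on the whole line, hence measurable. *)
Definition primitive (g : R -> R) (y : R) : R := \int[leb]_(t in `]-oo, y]) g t.

Lemma primitive_bounded (T M : R) (g : R -> R) : 0 < M -> 0 <= T ->
  measurable_fun `[0, T]%classic g ->
  (forall t, t \in `[0, T] -> `|g t| <= M) ->
  (forall x y, x <= y ->
     `|primitive (g \_ `[0, T]%classic) y - primitive (g \_ `[0, T]%classic) x|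
     <= M * (y - x)) /\
  {ae leb, forall t, t \in `[0, T] ->
     is_derive t 1 (primitive (g \_ `[0, T]%classic)) (g t)}.
Proof.
move=> M0 T0 mg gM; set h := g \_ _.
have hM x : `|h x| <= M.
  rewrite /h patchE; case: ifPn; last by rewrite normr0 (ltW M0).
  by rewrite inE/= => /gM.
have ig : leb.-integrable `[0, T]%classic (EFin \o g).
  apply: measurable_bounded_integrable => //.
    exact: lebesgue_measure_itv_lty.
  exact: bounded_near_cst gM.
have ih : leb.-integrable setT (EFin \o h).
  by have := (integrable_mkcond _ _).1 ig; rewrite /h -restrict_EFin; apply.
have ihS (A : set R) : measurable A -> leb.-integrable A (EFin \o h).
  by move=> mA; exact: integrableS ih.
split.
  move=> x y; rewrite le_eqVlt => /predU1P[->|xy].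
    by rewrite !subrr normr0 mulr0.
  rewrite /primitive Rintegral_itvB ?bnd_simp ?(ltW xy)//; last exact: ihS.
  apply: le_trans (le_normr_Rintegral _ _) _ => //; first exact: ihS.
  apply: (@le_trans _ _ (\int[leb]_(t in `]x, y]%classic) M)).
    apply: le_Rintegral => //.
    - by apply: integrable_norm; exact: ihS.
    - apply: measurable_bounded_integrable => //.
        exact: lebesgue_measure_itv_lty.
      by apply: (@bounded_near_cst _ _ _ _ M) => t _; rewrite ger0_norm// ltW.
  rewrite Rintegral_cst//= lebesgue_measure_itv/= lte_fin xy -EFinD/= //.
(* Lebesgue differentiation gives the derivative [h] almost everywhere, and [h] agrees with [g] on
   [[0, T]]. *)
have := FTC1Ny (fun y => ihS _ (measurable_itv _)) (open_integrable_locally openT ih).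
apply: ae_impl => t [dt Dt] tT; apply: DeriveDef => //.
by rewrite -derive1E Dt /h patchE mem_set.
Qed.

End Primitive.

(** * Picard iteration for a bounded, globally Lipschitz backward system *)

Section Picard.
Context (R : realType) (T L M : R) (G : bool -> R -> R -> R -> R).
Notation leb := (@lebesgue_measure R).
Hypotheses (T0 : 0 < T) (L0 : 0 < L) (M0 : 0 < M).
Hypothesis GL : forall b t p q p' q', t \in `[0, T] ->
  `|G b t p q - G b t p' q'| <= L * (`|p - p'| + `|q - q'|).
Hypothesis GM : forall b t p q, t \in `[0, T] -> `|G b t p q| <= M.
Hypothesis mG : forall b (p q : R -> R),
  measurable_fun setT p -> measurable_fun setT q ->
  measurable_fun `[0, T]%classic (fun t => G b t (p t) (q t)).
Implicit Types X Y : bool -> R -> R.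

(** The difference of primitives is the integral from [t] to [T]: the Picard map for the terminal
    value [1]. *)
Definition picard X b t : R :=
  let h := (fun s => G b s (X b s) (X (~~ b) s)) \_ `[0, T]%classic in
  1 + (primitive h T - primitive h t).

Let mX X := forall b, measurable_fun setT (X b).

Lemma picard_lip X b x y : mX X -> x <= y ->
  `|picard X b y - picard X b x| <= M * (y - x).
Proof.
move=> mx xy; rewrite /picard; set h := _ \_ _.
have -> : 1 + (primitive h T - primitive h y) - (1 + (primitive h T - primitive h x))
  = - (primitive h y - primitive h x) by ring.
rewrite normrN; have [+ _] := primitive_bounded M0 (ltW T0) (mG b (mx b) (mx (~~ b)))
  (fun t => @GM b t _ _).
exact.
Qed.

Lemma picard_measurable X : mX X -> mX (picard X).
Proof.
move=> mx b; apply: continuous_measurable_fun.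
by apply: (lip_continuous M0) => x y; exact: picard_lip.
Qed.

Lemma picard_end X b : picard X b T = 1.
Proof. by rewrite /picard subrr addr0. Qed.

Lemma picard_derive X b : mX X -> {ae leb, forall t, t \in `[0, T] ->
  is_derive t 1 (picard X b) (- G b t (X b t) (X (~~ b) t))}.
Proof.
move=> mx; have [_] := primitive_bounded M0 (ltW T0) (mG b (mx b) (mx (~~ b)))
  (fun t => @GM b t _ _).
apply: ae_impl => t Ht /Ht dp.
have := is_deriveD (is_derive_cst (1 : R^o) t 1)
  (is_deriveB (is_derive_cst (_ : R^o) t 1) dp).
by rewrite add0r sub0r; apply.
Qed.

(** The weight of a Bielecki norm, equal to [1] at [T]. The two components together contribute
    [2 * L], so the rate [4 * L] yields the contraction factor [1 / 2]. *)
Let E t : R := expR (- (4 * L) * t + 4 * L * T).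

(** The difference of the images minus [A / 2 * E] has derivative at least
    [- 2 * L * A * E + 2 * L * A * E = 0] almost everywhere and equals [- A / 2] at [T], so it is
    nonpositive on [[0, T]]. *)
Lemma picard_contract X Y (A : R) : mX X -> mX Y -> 0 <= A ->
  (forall b t, t \in `[0, T] -> `|X b t - Y b t| <= A * E t) ->
  forall b t, t \in `[0, T] -> `|picard X b t - picard Y b t| <= A / 2 * E t.
Proof.
have [L1 M1 T1] : [/\ 0 < L, 0 < M & 0 < T] by [].
move=> + + A0; wlog suff H : X Y / mX X -> mX Y ->
    (forall b t, t \in `[0, T] -> `|X b t - Y b t| <= A * E t) ->
    forall b t, t \in `[0, T] -> picard X b t - picard Y b t <= A / 2 * E t.
  move=> mx my XY b t tT; rewrite ler_norml lerNl opprB; apply/andP; split.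
    by apply: H => // b' s sT; rewrite distrC; exact: XY.
  exact: H.
move=> mx my XY b t tT; have := tT; rewrite in_itv/= => /andP[t0 tleT].
pose f t := picard X b t - picard Y b t - A / 2 * E t.
have L4 : 0 < 4 * L by rewrite mulr_gt0.
have ET : E T = 1 by rewrite /E mulNr addNr expR0.
suff : f t <= f T by rewrite /f !picard_end ET; lra.
apply: (abs_cont_ge0_derive_le (T := T) (f' := fun t =>
  (- G b t (X b t) (X (~~ b) t) - - G b t (Y b t) (Y (~~ b) t))
  - (A / 2) * (- (4 * L) * E t))) => //.
- have E0 : 0 < expR (4 * L * T) by exact: expR_gt0.
  apply: (@lipschitz_abs_cont _ _ _ (2 * M + A / 2 * (4 * L * expR (4 * L * T)))).
    apply: ltr_wpDr; last lra.
    by rewrite mulr_ge0 ?divr_ge0// mulr_ge0 ?(ltW L4)// ltW.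
  move=> x y x0 xy yT.
  have -> : f y - f x = (picard X b y - picard X b x)
    - (picard Y b y - picard Y b x) - (A / 2 * (E y - E x)) by rewrite /f; ring.
  apply: le_trans (ler_normB _ _) _.
  apply: le_trans (lerD (ler_normB _ _) (lexx _)) _.
  have := picard_lip b mx xy; have := picard_lip b my xy => Hy Hx.
  have EE s : E s = expR (4 * L * (- s) + 4 * L * T) by rewrite /E mulrN mulNr.
  have Eyx : `|E y - E x| <= 4 * L * expR (4 * L * T) * (y - x).
    rewrite distrC !EE; apply: le_trans (expR_affine_lip _ _ _) _; rewrite ?lerN2//.
      exact: ltW.
    rewrite opprK [_ + y]addrC ler_wpM2r ?subr_ge0// ler_wpM2l ?(ltW L4)//.
    rewrite ler_expR; nra.
  rewrite normrM (ger0_norm (_ : 0 <= A / 2)) ?divr_ge0//.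
  have := ler_wpM2l (_ : 0 <= A / 2) Eyx; rewrite divr_ge0// => /(_ isT); lra.
- have := ae_and (picard_derive b mx) (picard_derive b my).
  apply: ae_impl => s [dx dy] sT.
  have := is_deriveB (is_deriveB (dx sT) (dy sT))
    (is_deriveZ (A / 2) (is_derive_expR_affine (- (4 * L)) (4 * L * T) s)).
  exact.
move=> s sT; have Es : 0 < E s by exact: expR_gt0.
have := le_trans (ler_norm _) (@GL b s (X b s) (X (~~ b) s) (Y b s) (Y (~~ b) s) sT).
have := ler_wpM2l (ltW L1) (lerD (XY b s sT) (XY (~~ b) s sT)).
by lra.
Qed.

(** The intervals of center [u k] and radius [2 * B / 2 ^ k] are nested, since the radius drops by
    [B / 2 ^ k] at each step; the limit is the supremum of their left ends. *)
Lemma geometric_limit (u : nat -> R) (B : R) :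
  (forall k, `|u k.+1 - u k| <= B / 2 ^+ k) ->
  exists l, forall k, `|u k - l| <= 2 * B / 2 ^+ k.
Proof.
move=> uB; pose r k := 2 * B / 2 ^+ k.
have rS k : r k.+1 = r k / 2 by rewrite /r exprS; field; rewrite expf_neq0.
have rB k : r k = 2 * (B / 2 ^+ k) by rewrite /r mulrA.
pose v k := u k - r k; pose w k := u k + r k.
have r0 k : 0 <= r k.
  by have := le_trans (normr_ge0 _) (uB k); have := rB k; lra.
have vS k : v k <= v k.+1.
  by have := uB k; rewrite ler_norml /v rS => /andP[? ?]; have := rB k; lra.
have wS k : w k.+1 <= w k.
  by have := uB k; rewrite ler_norml /w rS => /andP[? ?]; have := rB k; lra.
have vh : {homo v : i j / (i <= j)%N >-> i <= j}.
  by apply: homo_leq => //; exact: le_trans.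
have wh : {homo w : i j / (i <= j)%N >-> j <= i}.
  by apply: homo_leq => // x y z yx zy; exact: le_trans zy yx.
have vw i j : v i <= w j.
  apply: le_trans (vh _ _ (leq_maxl i j)) _.
  apply: le_trans (wh _ _ (leq_maxr i j)).
  by rewrite /v /w; have := r0 (maxn i j); lra.
have hs : has_ubound (range v) by exists (w 0) => _ [i _ <-].
exists (sup (range v)) => k; rewrite -/(r k) ler_norml.
have : v k <= sup (range v) by apply: ub_le_sup => //; exists k.
have : sup (range v) <= w k.
  by apply: ge_sup; [exists (v 0), 0|move=> _ [i _ <-]].
by rewrite /v /w => ? ?; apply/andP; split; lra.
Qed.

(** Passes to the limit in inequalities with a geometric error, using [n < 2 ^ n] and the
    Archimedean property. *)
Lemma le_geometric (a d c : R) : 0 <= c ->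
  (forall k : nat, a <= d + c / 2 ^+ k) -> a <= d.
Proof.
move=> c0 H; rewrite leNgt; apply/negP => da.
have ad : 0 < a - d by rewrite subr_gt0.
have := archi_boundP (divr_ge0 c0 (ltW ad)); set n := Num.bound _ => cn.
have n2 : n%:R <= 2 ^+ n :> R by rewrite -natrX ler_nat ltnW// ltn_expl.
have p2 : 0 < 2 ^+ n :> R by rewrite exprn_gt0.
have : c / 2 ^+ n < a - d.
  by rewrite ltr_pdivrMr// mulrC -ltr_pdivrMr//; exact: lt_le_trans n2.
by have := H n; lra.
Qed.

Lemma picard_existence : exists X : bool -> R -> R,
  [/\ forall b, abs_cont 0 T (X b),
      forall b, X b T = 1 &
      forall b, {ae leb, forall t, t \in `[0, T] ->
        is_derive t 1 (X b) (- G b t (X b t) (X (~~ b) t))}].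
Proof.
have [L1 M1 T1] : [/\ 0 < L, 0 < M & 0 < T] by [].
pose U k := iter k picard (fun _ _ => 1).
have mU k : mX (U k).
  elim: k => [b|k IH]; first exact: measurable_cst.
  exact: picard_measurable IH.
have E1 t : t \in `[0, T] -> 1 <= E t.
  rewrite in_itv/= => /andP[t0 tT]; rewrite -expR0 ler_expR.
  have : 0 <= L * (T - t) by rewrite mulr_ge0 ?(ltW L1)// subr_ge0.
  lra.
have MT0 : 0 < M * T by rewrite mulr_gt0.
have U0 b t : t \in `[0, T] -> `|U 1%N b t - U 0%N b t| <= M * T * E t.
  move=> tT; have := tT; rewrite in_itv/= => /andP[t0 tleT].
  have := picard_lip b (mU 0%N) tleT; rewrite picard_end distrC => /le_trans; apply.
  apply: (@le_trans _ _ (M * T)); first by rewrite ler_wpM2l ?(ltW M0)//; lra.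
  by rewrite ler_peMr ?(ltW MT0)// E1.
have US k b t : t \in `[0, T] -> `|U k.+1 b t - U k b t| <= M * T / 2 ^+ k * E t.
  elim: k b t => [|k IH] b t tT; first by rewrite expr0 divr1; exact: U0.
  have Ak : 0 <= M * T / 2 ^+ k by rewrite divr_ge0 ?exprn_ge0// ltW.
  have := picard_contract (mU k.+1) (mU k) Ak IH b tT.
  have -> : M * T / 2 ^+ k / 2 = M * T / 2 ^+ k.+1; last exact.
  by rewrite exprSr invfM mulrA.
(* Limits are taken at the time clamped to [[0, T]], so that the limit is Lipschitz on the whole
   line; it is then measurable and [picard] can be applied to it. *)
have clT t : Num.min T (Num.max 0 t) \in `[0, T].
  by rewrite in_itv/= ge_min lexx/= le_min (ltW T0) le_max lexx.
have clE t : t \in `[0, T] -> Num.min T (Num.max 0 t) = t.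
  by rewrite in_itv/= => /andP[t0 tT]; rewrite (max_idPr t0) (min_idPr tT).
have /choice[W HW] : forall bt : bool * R, exists l, forall k,
    let t := Num.min T (Num.max 0 bt.2) in
    `|U k bt.1 t - l| <= 2 * (M * T * E t) / 2 ^+ k.
  move=> [b t]; apply: geometric_limit => k /=.
  by have := US k b _ (clT t); rewrite mulrAC.
pose cl t := Num.min T (Num.max 0 t).
have clP t : [\/ t <= 0 /\ cl t = 0, 0 <= t <= T /\ cl t = t | T <= t /\ cl t = T].
  rewrite /cl; have [t0|t0] := leP 0 t; last first.
    by apply: Or31; rewrite (min_idPr (ltW T0)) ltW.
  have [tT|tT] := leP T t; first exact: Or33.
  by apply: Or32; split => //; apply/andP; split => //; exact: ltW.
pose X b t := W (b, cl t).
have XU k b t : `|U k b (cl t) - X b t| <= 2 * (M * T) / 2 ^+ k * E (cl t).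
  have /= := HW (b, cl t) k; rewrite (clE _ (clT t)) => /le_trans; apply.
  by rewrite le_eqVlt; apply/orP; left; apply/eqP; ring.
pose B := expR (4 * L * T).
have EB t : t \in `[0, T] -> E t <= B.
  rewrite in_itv/= => /andP[t0 tT]; rewrite ler_expR.
  have : 0 <= L * t by rewrite mulr_ge0 ?(ltW L1).
  lra.
have B0 : 0 < B by exact: expR_gt0.
have X_lip b x y : x <= y -> `|X b y - X b x| <= M * (y - x).
  move=> xy; apply: (@le_geometric _ _ (4 * (M * T) * B)) => [|k].
    by apply: mulr_ge0; [lra|exact: ltW].
  have [clxy clxy'] : cl x <= cl y /\ cl y - cl x <= y - x.
    by case: (clP x) => -[? ->]; case: (clP y) => -[? ->]; split; lra.
  have -> : X b y - X b x = (U k b (cl y) - U k b (cl x))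
    - (U k b (cl y) - X b y) + (U k b (cl x) - X b x) by ring.
  apply: le_trans (ler_normD _ _) _.
  apply: le_trans (lerD (ler_normB _ _) (lexx _)) _.
  have Uxy : `|U k b (cl y) - U k b (cl x)| <= M * (y - x).
    case: k => [|k]; first by rewrite subrr normr0 mulr_ge0 ?(ltW M1)// subr_ge0.
    by apply: le_trans (picard_lip b (mU k) clxy) _; rewrite ler_wpM2l// ltW.
  have r0 : 0 <= 2 * (M * T) / 2 ^+ k.
    by rewrite divr_ge0 ?exprn_ge0// mulr_ge0// ltW.
  have Hx := le_trans (XU k b x) (ler_wpM2l r0 (EB _ (clT x))).
  have Hy := le_trans (XU k b y) (ler_wpM2l r0 (EB _ (clT y))).
  have -> : 4 * (M * T) * B / 2 ^+ k = 2 * (2 * (M * T) / 2 ^+ k * B) by ring.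
  lra.
have mx : mX X.
  move=> b; apply: continuous_measurable_fun.
  by apply: (lip_continuous M0) => x y; exact: X_lip.
(* Both sides are geometrically close to the iterate [U k.+1]: [X] as the limit, [picard X] by
   contraction from [U k] and [X]. *)
have XE b t : t \in `[0, T] -> X b t = picard X b t.
  move=> tT; apply/eqP; rewrite -subr_eq0 -normr_le0.
  apply: (@le_geometric _ _ (2 * (M * T) * B)) => [|k].
    by apply: mulr_ge0; [lra|exact: ltW].
  have r0 : 0 <= 2 * (M * T) / 2 ^+ k.
    by rewrite divr_ge0 ?exprn_ge0// mulr_ge0// ltW.
  have XUk b' s : s \in `[0, T] -> `|U k b' s - X b' s| <= 2 * (M * T) / 2 ^+ k * E s.
    by move=> sT; have := XU k b' s; rewrite /cl clE.
  have H1 := picard_contract (mU k) mx r0 XUk b tT.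
  have := XU k.+1 b t; rewrite /cl (clE t tT) => H2.
  have -> : X b t - picard X b t = (U k.+1 b t - picard X b t) - (U k.+1 b t - X b t).
    by ring.
  apply: le_trans (ler_normB _ _) _; apply: le_trans (lerD H1 H2) _.
  have p2 : 2 ^+ k != 0 :> R by rewrite expf_neq0.
  have -> : 2 * (M * T) / 2 ^+ k.+1 * E t = 2 * (M * T) / 2 ^+ k / 2 * E t.
    by rewrite exprS; field.
  have := ler_wpM2l r0 (EB _ tT).
  have -> : 2 * (M * T) * B / 2 ^+ k = 2 * (M * T) / 2 ^+ k * B by ring.
  lra.
(* The derivative of [picard X] is known directly; the equality with [X] on [[0, T]] only has to be
   used in the arguments of [G]. *)
exists (picard X); split.
- move=> b; apply: (lipschitz_abs_cont M0) => x y _ xy _; exact: picard_lip.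
- by move=> b; exact: picard_end.
- move=> b; have := picard_derive b mx; apply: ae_impl => t + tT => /(_ tT).
  by rewrite !XE.
Qed.

End Picard.

(** * The abstract coupled equation *)

Section CoupledODE.
Context (R : realType) (T : R) (F : bool -> R -> R -> R -> R).
Notation leb := (@lebesgue_measure R).

(* The components [P_+] and [P_-] are indexed by [true] and [false]; [F b] takes
   the value of component [b] first, which makes the system symmetric. *)
Definition coupled_solution (P : bool -> R -> R) : Prop :=
  [/\ forall b, abs_cont 0 T (P b),
      forall b, {ae leb, forall t, t \in `[0, T] ->
        is_derive t 1 (P b) (- F b t (P b t) (P (~~ b) t))},
      forall b, P b T = 1 &
      forall b t, t \in `[0, T] -> 0 < P b t].

(** [c] is the value at time [0] of the exponential barrier, its minimum on [[0, T]]. The bounds by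
    [c] and [1] are used twice: for the solution of the cut-off system, where they show that the
    cut-off is inactive, and for a competitor [Q], for which only positivity is known in advance. *)
Lemma coupled_ode (C L M : R) (c := expR (C * (0 - T))) :
  0 < T -> 0 < C -> 0 < L -> 0 < M ->
  (forall b t p q, t \in `[0, T] -> 0 < p -> 0 < q -> F b t p q <= 0) ->
  (forall b t p q, t \in `[0, T] -> 0 < p -> p <= q -> - (C * p) <= F b t p q) ->
  (forall b t p q p' q', t \in `[0, T] -> c <= p <= 1 -> c <= q <= 1 ->
     c <= p' <= 1 -> c <= q' <= 1 ->
     `|F b t p q - F b t p' q'| <= L * (`|p - p'| + `|q - q'|)) ->
  (forall b t p q, t \in `[0, T] -> c <= p <= 1 -> c <= q <= 1 ->
     `|F b t p q| <= M) ->
  (forall b (p q : R -> R), measurable_fun setT p -> measurable_fun setT q ->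
     (forall t, c <= p t <= 1) -> (forall t, c <= q t <= 1) ->
     measurable_fun `[0, T]%classic (fun t => F b t (p t) (q t))) ->
  exists P : bool -> R -> R,
    [/\ coupled_solution P,
        forall b t, t \in `[0, T] -> c <= P b t <= 1 &
        forall Q, coupled_solution Q ->
          forall b t, t \in `[0, T] -> Q b t = P b t].
Proof.
move=> T0 C0 L0 M0 F0 FC FL FM mF.
pose e t := expR (C * (t - T)).
have c0 : 0 < c by exact: expR_gt0.
have ce t : t \in `[0, T] -> c <= e t.
  by rewrite in_itv/= => /andP[t0 _]; rewrite ler_expR ler_wpM2l ?(ltW C0)// lerD2r.
have TT : T \in `[0, T] by rewrite in_itv/= lexx ltW.
have OT : 0 \in `[0, T] by rewrite in_itv/= lexx ltW.
have c1 : c <= 1 by have := ce T TT; rewrite /e subrr mulr0 expR0.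
pose cut x := Num.max c (Num.min x 1).
have cutP x : [\/ x <= c /\ cut x = c, c <= x <= 1 /\ cut x = x | 1 <= x /\ cut x = 1].
  rewrite /cut; have [x1|x1] := leP x 1; last first.
    by apply: Or33; rewrite (max_idPr c1) ltW.
  have [cx|xc] := leP c x; first by apply: Or32; split => //; exact/andP.
  by apply: Or31; rewrite ltW.
have cut_in x : c <= cut x <= 1.
  by case: (cutP x) => -[? ->] => //; rewrite ?lexx ?c1.
have cut_lip x y : `|cut x - cut y| <= `|x - y|.
  have := ler_norm (x - y); have := ler_norm (y - x); rewrite (distrC y) => ? ?.
  case: (cutP x) => -[? ->]; case: (cutP y) => -[? ->];
  by rewrite ler_norml; apply/andP; split; lra.
have cut_le x y : x <= y -> cut x <= cut y.
  by case: (cutP x) => -[? ->]; case: (cutP y) => -[? ->]; lra.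
have cut_id x : c <= x <= 1 -> cut x = x.
  by case: (cutP x) => -[? ->] /andP[? ?]; lra.
have cut_gt0 x : 0 < cut x by case/andP: (cut_in x) => /(lt_le_trans c0).
pose G b t p q := F b t (cut p) (cut q).
have mcut (p : R -> R) : measurable_fun setT p -> measurable_fun setT (cut \o p).
  move=> mp; apply: measurableT_comp mp; apply: continuous_measurable_fun.
  apply: (@lip_continuous _ _ 1) => // x y xy.
  by rewrite mul1r (le_trans (cut_lip _ _))// ger0_norm// subr_ge0.
have [X [acX XT dX]] : exists X : bool -> R -> R,
  [/\ forall b, abs_cont 0 T (X b), forall b, X b T = 1 &
      forall b, {ae leb, forall t, t \in `[0, T] ->
        is_derive t 1 (X b) (- G b t (X b t) (X (~~ b) t))}].
  apply: (@picard_existence _ T L M) => //.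
  - move=> b t p q p' q' tT; apply: le_trans (FL _ _ _ _ _ _ tT _ _ _ _) _ => //.
    by rewrite ler_wpM2l ?(ltW L0)// lerD.
  - by move=> b t p q tT; exact: FM.
  - by move=> b p q mp mq; apply: mF => //; exact: mcut.
(* The right-hand side is an abstract [g], so that this covers both the cut-off system and the
   original one. *)
have le1 (Q : bool -> R -> R) (g : bool -> R -> R) :
    (forall b, abs_cont 0 T (Q b)) ->
    (forall b, {ae leb, forall t, t \in `[0, T] -> is_derive t 1 (Q b) (- g b t)}) ->
    (forall b, Q b T = 1) -> (forall b t, t \in `[0, T] -> g b t <= 0) ->
    forall b t, t \in `[0, T] -> Q b t <= 1.
  move=> acQ dQ QT g0 b t; rewrite in_itv/= => /andP[t0 tT]; rewrite -(QT b).
  apply: (abs_cont_ge0_derive_le t0 tT (lexx T) (acQ b) (dQ b)) => s sT.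
  by rewrite oppr_ge0 g0.
have X1 := le1 X _ acX dX XT (fun b t tT => F0 b t _ _ tT (cut_gt0 _) (cut_gt0 _)).
have Xe : forall b t, t \in `[0, T] -> e t <= X b t.
  apply: (decay_lower_bound C0 acX dX XT) => b t tT Xle XeT.
  (* Cutting off can increase a value only up to [c], and [c <= e t]. *)
  have cutX : cut (X b t) <= e t.
    rewrite /cut ge_max ce//= ge_min; apply/orP; left.
    exact: XeT.
  have := FC b t _ _ tT (cut_gt0 (X b t)) (cut_le _ _ Xle).
  have := ler_wpM2l (ltW C0) cutX; rewrite /G /e; lra.
have Xc b t : t \in `[0, T] -> c <= X b t <= 1.
  by move=> tT; rewrite X1// (le_trans (ce t tT))// Xe.
have solX : coupled_solution X.
  split => //; last first.
    by move=> b t /(Xc b)/andP[/(lt_le_trans c0)].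
  move=> b; move: (dX b); apply: ae_impl => t + tT => /(_ tT).
  by rewrite /G !cut_id// Xc.
exists X; split => // Q [acQ dQ QT Q0].
have Q1 := le1 Q _ acQ dQ QT (fun b t tT => F0 b t _ _ tT (Q0 b t tT) (Q0 _ t tT)).
have Qe : forall b t, t \in `[0, T] -> e t <= Q b t.
  apply: (decay_lower_bound C0 acQ dQ QT) => b t tT Qle QeT.
  have := FC b t _ _ tT (Q0 b t tT) Qle.
  have := ler_wpM2l (ltW C0) QeT; rewrite /e; lra.
have Qc b t : t \in `[0, T] -> c <= Q b t <= 1.
  by move=> tT; rewrite Q1// (le_trans (ce t tT))// Qe.
case: solX => _ dX' _ _ b t tT; apply/eqP; rewrite -subr_eq0; apply/eqP.
apply: (@backward_uniqueness _ T L (fun b t => Q b t - X b t) (fun b t =>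
  - F b t (Q b t) (Q (~~ b) t) - - F b t (X b t) (X (~~ b) t))) => //.
- move=> {}b; apply: (abs_cont_lip2 (K := 1) _ (acQ b) (acX b)) => // x y x0 xy yT.
  rewrite mul1r.
  have -> : Q b y - X b y - (Q b x - X b x) = (Q b y - Q b x) - (X b y - X b x) by ring.
  by apply: le_trans (ler_normB _ _) _; rewrite lerDl subr_ge0.
- move=> {}b; have := ae_and (dQ b) (dX' b); apply: ae_impl => s [dq dx] sT.
  by have := is_deriveB (dq sT) (dx sT); apply.
- move=> {}b s sT; have /andP[? ?] := Qc b s sT; have /andP[? ?] := Xc b s sT.
  by rewrite ler_norml; apply/andP; split; lra.
- move=> {}b s sT; rewrite opprK addrC distrC.
  apply: le_trans (FL _ _ _ _ _ _ sT _ _ _ _) _; rewrite ?Qc ?Xc//.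
  by case: b => //=; rewrite [X in _ * X <= _]addrC.
- by move=> {}b; rewrite QT XT subrr.
Qed.

End CoupledODE.

(** * Minimization of strongly convex functions over the orthant *)

Section MatrixNorm.
Context (R : realType).

Lemma ler_mx_norm_entry (m n : nat) (A : 'M[R]_(m, n)) i j : `|A i j| <= `|A|.
Proof.
by rewrite [leRHS]/Num.norm/= mx_normrE; apply/bigmax_geP; right; exists (i, j).
Qed.

Lemma mx_norm_le_entries (m n : nat) (A : 'M[R]_(m, n)) (r : R) : 0 <= r ->
  (forall i j, `|A i j| <= r) -> `|A| <= r.
Proof.
move=> r0 Ar; rewrite [leLHS]/Num.norm/= mx_normrE.
by apply/bigmax_leP; split => // -[i j] _; exact: Ar.
Qed.

Lemma mx_norm_trmx (m n : nat) (A : 'M[R]_(m, n)) : `|A^T| = `|A|.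
Proof.
apply/eqP; rewrite eq_le; apply/andP; split; apply: mx_norm_le_entries => // i j.
  by rewrite mxE ler_mx_norm_entry.
by have := ler_mx_norm_entry A^T j i; rewrite mxE.
Qed.

End MatrixNorm.

Section Minimization.
Context (R : realType) (m : nat).
Notation V := 'cV[R]_m.
Notation orthant := (@nonneg_vec R m).

(** The constant is an explicit function of the radius, so that one modulus can serve all times. *)
Definition locally_lipschitz (f : V -> R) (Lam : R -> R) : Prop :=
  forall r v w, `|v| <= r -> `|w| <= r -> `|f v - f w| <= Lam r * `|v - w|.

(* The assumptions on the coefficients [A], [B] of the Hamiltonian
   [p * A v + q * B v] at a fixed time: coercivity and strong (midpoint)
   convexity. *)
Definition strongly_convex_pair (del K : R) (Lam : R -> R) (A B : V -> R) : Prop :=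
  [/\ A 0 = 0 /\ B 0 = 0,
      locally_lipschitz A Lam /\ locally_lipschitz B Lam,
      forall p q v, 0 < p -> 0 < q ->
        Num.min p q * (del * `|v| ^+ 2) - 2 * p * K * `|v| <= p * A v + q * B v &
      forall p q v w, 0 < p -> 0 < q ->
        p * A (2^-1 *: (v + w)) + q * B (2^-1 *: (v + w))
          + Num.min p q * (del * `|v - w| ^+ 2) / 4
        <= (p * A v + q * B v + (p * A w + q * B w)) / 2].

Definition min_value (A B : V -> R) (p q : R) : R :=
  inf [set p * A v + q * B v | v in orthant].

Lemma orthant0 : orthant 0.
Proof. by move=> i; rewrite mxE. Qed.

Lemma locally_lipschitz_continuous (f : V -> R) Lam :
  locally_lipschitz f Lam -> continuous f.
Proof.
move=> fL v; have FF := nbhs_filter v.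
apply/(cvgrPdist_lt (FF := FF)) => e e0.
have L0 : 0 < `|Lam (`|v| + 1)| + 1 by rewrite ltr_wpDl.
apply/(@nbhs_ballP R V); exists (Num.min 1 (e / (`|Lam (`|v| + 1)| + 1))).
  by rewrite /= lt_min ltr01 divr_gt0.
move=> w; rewrite mx_norm_ball /= lt_min ltr_pdivlMr// => /andP[vw1 vwe].
have wv : `|w| <= `|v| + 1.
  have -> : w = v - (v - w) by rewrite opprB addrC subrK.
  by apply: le_trans (ler_normB _ _) _; rewrite lerD2l ltW.
apply: le_lt_trans (fL (`|v| + 1) _ _ _ wv) _; first by rewrite lerDl.
apply: le_lt_trans vwe; rewrite mulrC ler_wpM2l//.
by rewrite (le_trans (ler_norm _))// lerDl.
Qed.

Section FixedTime.
Context (del K : R) (Lam : R -> R) (A B : V -> R).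
Hypotheses (del_gt0 : 0 < del) (K_gt0 : 0 < K).
Hypothesis AB : strongly_convex_pair del K Lam A B.

Lemma quadratic_ge (k r c : R) : 0 < c ->
  - (k ^+ 2 / c) <= c * r ^+ 2 - 2 * k * r.
Proof.
move=> c0; rewrite lerNl ler_pdivlMr// -subr_ge0.
have -> : k ^+ 2 - - (c * r ^+ 2 - 2 * k * r) * c = (k - c * r) ^+ 2 by ring.
exact: sqr_ge0.
Qed.

Lemma pair_ge (p q : R) v : 0 < p -> 0 < q ->
  - (p ^+ 2 * K ^+ 2 / (Num.min p q * del)) <= p * A v + q * B v.
Proof.
move=> p0 q0; have [_ _ co _] := AB; apply: le_trans (co p q v p0 q0).
have c0 : 0 < Num.min p q * del by rewrite mulr_gt0// lt_min p0.
by have := quadratic_ge (p * K) `|v| c0; rewrite exprMn !mulrA.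
Qed.

(** The value at [0] is [0], and coercivity confines the set of nonpositive values to the ball of
    radius [r]; a minimum over the compact box with sides [[0, r]] is therefore global on the
    orthant. *)
Lemma minimizer_exists (p q : R) : 0 < p -> 0 < q ->
  exists v, [/\ orthant v,
    forall w, orthant w -> p * A v + q * B v <= p * A w + q * B w &
    `|v| <= 2 * p * K / (Num.min p q * del)].
Proof.
move=> p0 q0; have [[A0 B0] [LA LB] co _] := AB.
have [dg0 kg0] : 0 < del /\ 0 < K by [].
have c0 : 0 < Num.min p q * del by rewrite mulr_gt0// lt_min p0.
pose r := 2 * p * K / (Num.min p q * del).
have r0 : 0 <= r by rewrite divr_ge0 ?(ltW c0)// !mulr_ge0// ltW.
have H_small v : p * A v + q * B v <= 0 -> `|v| <= r.
  move=> Hv; rewrite leNgt; apply/negP => rv.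
  have v0 : 0 < `|v| by exact: le_lt_trans rv.
  have := le_trans (co p q v p0 q0) Hv; rewrite leNgt => /negP; apply.
  rewrite subr_gt0 expr2 !mulrA ltr_pM2r//.
  by rewrite -ltr_pdivrMl// mulrC.
(* Transposition to row vectors makes [rV_compact] and [EVT_min_rV] applicable; it preserves the
   norm. *)
pose f (u : 'rV[R]_m) := p * A u^T + q * B u^T.
have cont_tr (g : V -> R) : continuous g -> continuous (fun u : 'rV[R]_m => g u^T).
  move=> cg u; apply: (@continuous_comp _ _ _ trmx g); last exact: cg.
  have FF := nbhs_filter u.
  apply/(cvgrPdist_lt (FF := FF)) => e e0.
  apply/(@nbhs_ballP R 'rV[R]_m); exists e => // w; rewrite mx_norm_ball /=.
  by rewrite -linearB mx_norm_trmx.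
have cf : continuous f.
  pose LH r := p * Lam r + q * Lam r.
  have LpAqB : locally_lipschitz (fun v => p * A v + q * B v) LH.
    move=> s v w vs ws.
    have -> : p * A v + q * B v - (p * A w + q * B w)
      = p * (A v - A w) + q * (B v - B w) by ring.
    apply: le_trans (ler_normD _ _) _; rewrite !normrM (gtr0_norm p0) (gtr0_norm q0).
    rewrite /LH mulrDl -!mulrA; apply: lerD.
      by rewrite ler_pM2l//; exact: LA.
    by rewrite ler_pM2l//; exact: LB.
  exact: (cont_tr _ (locally_lipschitz_continuous LpAqB)).
pose S := [set u : 'rV[R]_m | forall i, `[0, r]%classic (u ord0 i)].
have cS : compact S.
  apply: (@rV_compact _ _ (fun=> `[0, r]%classic)) => _.
  by apply: segment_compact.
have S0 : S 0 by move=> i; rewrite mxE /= in_itv/= lexx.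
have [|u /set_mem uS umin] := EVT_min_rV (f := f) (ex_intro _ _ S0) cS.
  exact: continuous_subspaceT cf.
have fu0 : f u <= 0.
  apply: le_trans (umin 0 (mem_set S0)) _.
  by rewrite /f trmx0 A0 B0 !mulr0 addr0.
exists u^T; split.
- by move=> i; rewrite mxE; have := uS i; rewrite /= in_itv/= => /andP[].
- move=> w ow; have [w0|w0] := leP (p * A w + q * B w) 0; last first.
    exact: le_trans fu0 (ltW w0).
  have := umin w^T; rewrite /f trmxK; apply; apply/mem_set => i.
  rewrite /= in_itv/= mxE ow/=; apply: le_trans (ler_norm _) _.
  exact: le_trans (ler_mx_norm_entry _ _ _) (H_small _ w0).
- exact: H_small fu0.
Qed.

(** By strong convexity the midpoint of two distinct minimizers would have a strictly smaller
    value. *)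
Lemma minimizer_unique (p q : R) v w : 0 < p -> 0 < q ->
  orthant v -> orthant w ->
  (forall u, orthant u -> p * A v + q * B v <= p * A u + q * B u) ->
  (forall u, orthant u -> p * A w + q * B w <= p * A u + q * B u) -> v = w.
Proof.
move=> p0 q0 ov ow vmin wmin; have [_ _ _ conv] := AB.
have dg0 := del_gt0.
apply/eqP; rewrite -subr_eq0 -normr_eq0 -sqrf_eq0 eq_le sqr_ge0 andbT.
have omid : orthant (2^-1 *: (v + w)).
  by move=> i; rewrite !mxE mulr_ge0 ?invr_ge0// addr_ge0.
have := conv p q v w p0 q0; have := vmin _ omid; have := wmin _ omid.
have := vmin _ ow; have := wmin _ ov.
have c0 : 0 < Num.min p q * del by rewrite mulr_gt0// lt_min p0.
rewrite mulrA; move: (Num.min p q * del) c0 (`|v - w| ^+ 2) => c c0 d H1 H2 H3 H4 H5.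
have : c * d <= 0 by lra.
by rewrite pmulr_rle0.
Qed.

Lemma has_lbound_pair (p q : R) : 0 < p -> 0 < q ->
  has_lbound [set p * A v + q * B v | v in orthant].
Proof.
move=> p0 q0; exists (- (p ^+ 2 * K ^+ 2 / (Num.min p q * del))).
by move=> _ [v _ <-]; exact: pair_ge.
Qed.

Lemma min_value_minimizer (p q : R) v : 0 < p -> 0 < q -> orthant v ->
  (forall w, orthant w -> p * A v + q * B v <= p * A w + q * B w) ->
  min_value A B p q = p * A v + q * B v.
Proof.
move=> p0 q0 ov vmin; apply/eqP; rewrite eq_le; apply/andP; split.
  by apply: ge_inf; [exact: has_lbound_pair|exists v].
by apply: lb_le_inf; [exists (p * A v + q * B v), v|move=> _ [w ow <-]; exact: vmin].
Qed.

Lemma min_value_le (p q : R) v : 0 < p -> 0 < q -> orthant v ->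
  min_value A B p q <= p * A v + q * B v.
Proof. by move=> p0 q0 ov; apply: ge_inf; [exact: has_lbound_pair|exists v]. Qed.

Lemma min_value_le0 (p q : R) : 0 < p -> 0 < q -> min_value A B p q <= 0.
Proof.
move=> p0 q0; apply: le_trans (min_value_le p0 q0 orthant0) _.
by have [[-> ->] _ _ _] := AB; rewrite !mulr0 addr0.
Qed.

(** When [min p q = p], one factor [p] cancels in [p ^ 2 * K ^ 2 / (p * del)]. The remaining
    [K ^ 2 / del] becomes the rate of the exponential barrier. *)
Lemma min_value_ge (p q : R) : 0 < p -> p <= q ->
  - (K ^+ 2 / del * p) <= min_value A B p q.
Proof.
move=> p0 pq; have q0 := lt_le_trans p0 pq.
apply: lb_le_inf; first by exists (p * A 0 + q * B 0), 0 => //; exact: orthant0.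
move=> _ [v _ <-]; apply: le_trans (pair_ge v p0 q0).
rewrite (min_idPl pq) lerN2 le_eqVlt; apply/orP; left; apply/eqP.
by field; rewrite !gt_eqF.
Qed.

Lemma minimizer_bound (c p q : R) : 0 < c -> c <= p <= 1 -> c <= q <= 1 ->
  2 * p * K / (Num.min p q * del) <= 2 * K / (c * del).
Proof.
move=> c0 /andP[cp p1] /andP[cq q1]; have kg0 := K_gt0; have dg0 := del_gt0.
have p0 := lt_le_trans c0 cp.
have cm : c * del <= Num.min p q * del by rewrite ler_wpM2r ?(ltW dg0)// le_min cp.
have cd0 : 0 < c * del by rewrite mulr_gt0.
apply: (@ler_pM _ _ (2 * K)) => //.
- by rewrite !mulr_ge0// ltW.
- by rewrite invr_ge0 (le_trans (ltW cd0)).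
- by nra.
- by rewrite lef_pV2// posrE// (lt_le_trans cd0).
Qed.

Lemma pair_bounded r v : `|v| <= r ->
  `|A v| <= `|Lam r| * r /\ `|B v| <= `|Lam r| * r.
Proof.
move=> vr; have [[A0 B0] [LA LB] _ _] := AB.
have r0 : 0 <= r by exact: le_trans vr.
have Lr (f : V -> R) : locally_lipschitz f Lam -> f 0 = 0 -> `|f v| <= `|Lam r| * r.
  move=> Lf f0; have := Lf r v 0 vr; rewrite normr0 f0 !subr0 => /(_ r0)/le_trans.
  apply; apply: (@le_trans _ _ (`|Lam r| * `|v|)).
    by rewrite ler_wpM2r// ler_norm.
  by rewrite ler_wpM2l.
by split; exact: Lr.
Qed.

(** Envelope argument: the minimizer for [(p, q)] is a competitor for [(p', q')]. The objective is
    linear in [(p, q)], and its coefficients at a point of the ball of radius [r] are at most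
    [|Lam r| * r]. *)
Lemma min_value_lip (c p q p' q' : R) : 0 < c ->
  c <= p <= 1 -> c <= q <= 1 -> c <= p' <= 1 -> c <= q' <= 1 ->
  let r := 2 * K / (c * del) in
  `|min_value A B p q - min_value A B p' q'|
    <= `|Lam r| * r * (`|p - p'| + `|q - q'|).
Proof.
move=> c0 + + + + /=; set r := 2 * K / _; wlog suff H : p q p' q' / c <= p <= 1 -> c <= q <= 1 ->
    c <= p' <= 1 -> c <= q' <= 1 ->
    min_value A B p' q' - min_value A B p q <= `|Lam r| * r * (`|p - p'| + `|q - q'|).
  move=> pc qc pc' qc'; rewrite ler_norml lerNl opprB H//=.
  by rewrite (distrC p) (distrC q) H.
move=> pc qc pc' qc'; have gt0 x : c <= x <= 1 -> 0 < x.
  by case/andP => /(lt_le_trans c0).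
have [v [ov vmin vr]] := minimizer_exists (gt0 _ pc) (gt0 _ qc).
rewrite (min_value_minimizer (gt0 _ pc) (gt0 _ qc) ov vmin) lerBlDr.
apply: le_trans (min_value_le (gt0 _ pc') (gt0 _ qc') ov) _.
have [Av Bv] := pair_bounded (le_trans vr (minimizer_bound c0 pc qc)).
rewrite -/r in Av Bv; rewrite -lerBlDr.
have -> : p' * A v + q' * B v - (p * A v + q * B v)
  = (p' - p) * A v + (q' - q) * B v by ring.
rewrite mulrDr; apply: lerD; apply: le_trans (ler_norm _) _;
  by rewrite normrM distrC mulrC ler_wpM2r.
Qed.

Lemma min_value_bounded (c p q : R) : 0 < c -> c <= p <= 1 -> c <= q <= 1 ->
  let r := 2 * K / (c * del) in
  `|min_value A B p q| <= 2 * (`|Lam r| * r).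
Proof.
move=> c0 pc qc /=; set r := 2 * K / _; have gt0 x : c <= x <= 1 -> 0 < x.
  by case/andP => /(lt_le_trans c0).
have [v [ov vmin vr]] := minimizer_exists (gt0 _ pc) (gt0 _ qc).
rewrite (min_value_minimizer (gt0 _ pc) (gt0 _ qc) ov vmin).
have [Av Bv] := pair_bounded (le_trans vr (minimizer_bound c0 pc qc)).
rewrite -/r in Av Bv; apply: le_trans (ler_normD _ _) _.
have le1 x y : c <= x <= 1 -> `|x * y| <= `|y|.
  move=> xc; rewrite normrM (gtr0_norm (gt0 _ xc)) ler_piMl//.
  by case/andP: xc.
by have := le1 _ (A v) pc; have := le1 _ (B v) qc; lra.
Qed.

End FixedTime.
End Minimization.

(** * Measurability in time of the minimal value *)

Section MeasurableMinimum.
Context (R : realType) (m : nat).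
Notation V := 'cV[R]_m.
Notation orthant := (@nonneg_vec R m).

(** Rational vectors are enumerated by [unpickle] and moved into the orthant by entrywise absolute
    values. Approximating each coordinate from above keeps the rationals positive, so that the
    absolute value does not disturb them. *)
Lemma orthant_dense_sequence : exists w : nat -> V,
  (forall k, orthant (w k)) /\
  forall v e, orthant v -> 0 < e -> exists k, `|v - w k| <= e.
Proof.
exists (fun k => if unpickle k is Some u
  then map_mx (fun x : rat => `|ratr x|) (u : 'cV[rat]_m) else 0); split.
  move=> k i; case: unpickle => [u|]; rewrite ?mxE//.
move=> v e ov e0.
have /choice[u Hu] : forall i, exists x : rat, ratr x \in `]v i 0, (v i 0 + e)[.
  by move=> i; apply: rat_in_itvoo; rewrite ltrDl.
exists (pickle (\col_i u i)); rewrite pickleK.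
apply: mx_norm_le_entries (ltW e0) _ => i j; rewrite !mxE (ord1 j).
have := Hu i; rewrite in_itv/= => /andP[vu uve].
have vi : 0 <= v i 0 := ov i.
rewrite (gtr0_norm (le_lt_trans vi vu)) distrC ger0_norm ?subr_ge0 ?(ltW vu)//.
by rewrite lerBlDl ltW.
Qed.

Lemma measurable_min_value (D : set R) (del K : R) (Lam : R -> R)
    (A B : R -> V -> R) (p q : R -> R) : 0 < del ->
  (forall t, D t -> strongly_convex_pair del K Lam (A t) (B t)) ->
  (forall v, measurable_fun D (A^~ v)) -> (forall v, measurable_fun D (B^~ v)) ->
  measurable_fun D p -> measurable_fun D q ->
  (forall t, D t -> 0 < p t /\ 0 < q t) ->
  measurable_fun D (fun t => min_value (A t) (B t) (p t) (q t)).
Proof.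
move=> del0 AB mA mB mp mq pq0.
have [w [ow wdense]] := orthant_dense_sequence.
pose h k t := p t * A t (w k) + q t * B t (w k).
have hlb t : D t -> has_lbound (range (h^~ t)).
  move=> Dt; have [p0 q0] := pq0 t Dt.
  have [b bP] := has_lbound_pair del0 (AB t Dt) p0 q0.
  by exists b => _ [k _ <-]; apply: bP; exists (w k).
apply: (@eq_measurable_fun _ _ _ _ D (fun t => infs (h^~ t) 0)); last first.
  apply: measurable_fun_infs => // k.
  by apply: measurable_funD; apply: measurable_funM.
move=> t /set_mem Dt; have [p0 q0] := pq0 t Dt.
have [_ [LA LB] _ _] := AB t Dt.
rewrite /infs /=; have -> : sdrop (h^~ t) 0 = range (h^~ t).
  by rewrite /sdrop; congr image; apply/seteqP; split.
apply/eqP; rewrite eq_le; apply/andP; split; last first.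
  apply: lb_le_inf; first by exists (h 0%N t), 0%N.
  by move=> _ [k _ <-]; exact: (min_value_le del0 (AB t Dt)).
apply: lb_le_inf.
  by exists (p t * A t 0 + q t * B t 0), 0 => //; exact: orthant0.
move=> _ [v ov <-]; apply/ler_addgt0Pr => e e0.
(* A Lipschitz constant of the objective on the ball of radius [|v| + 1], plus [1] to be positive. A
   distance at most [min 1 (e / S)] stays in that ball and costs at most [e]. *)
pose S := (p t + q t) * `|Lam (`|v| + 1)| + 1.
have S0 : 0 < S by rewrite ltr_wpDl// mulr_ge0// addr_ge0// ltW.
have d0 : 0 < Num.min 1 (e / S) by rewrite lt_min ltr01 divr_gt0.
have [k] := wdense v _ ov d0; rewrite le_min ler_pdivlMr// => /andP[vw1 vwe].
apply: (@le_trans _ _ (h k t)); first by apply: ge_inf; [exact: hlb|exists k].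
have wv : `|w k| <= `|v| + 1.
  have -> : w k = v - (v - w k) by rewrite opprB addrC subrK.
  by apply: le_trans (ler_normB _ _) _; rewrite lerD2l.
have lip f : locally_lipschitz f Lam ->
    f (w k) - f v <= `|Lam (`|v| + 1)| * `|v - w k|.
  move=> Lf; apply: le_trans (ler_norm _) _.
  rewrite distrC; apply: le_trans (Lf (`|v| + 1) _ _ _ wv) _; first by rewrite lerDl.
  by rewrite ler_wpM2r// ler_norm.
have := ler_wpM2l (ltW p0) (lip _ LA); have := ler_wpM2l (ltW q0) (lip _ LB).
have : 0 <= `|v - w k| by [].
by move: vwe; rewrite /h /S; lra.
Qed.

End MeasurableMinimum.

(** * Integrals depending measurably on a parameter *)

Section ParametricIntegral.
Context (R : realType).

(** Tonelli, applied to the extension of [f] by zero and to the restriction of [nu] to [E], which is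
    a finite measure. *)
Lemma measurable_fun_Rintegral_param d1 d2 (T1 : measurableType d1)
    (T2 : measurableType d2) (nu : {measure set T2 -> \bar R})
    (D : set T1) (E : set T2) (f : T1 -> T2 -> R) :
  measurable D -> measurable E -> (nu E < +oo)%E ->
  measurable_fun (D `*` E) (fun x => f x.1 x.2) ->
  (forall x y, D x -> E y -> 0 <= f x y) ->
  measurable_fun D (fun x => \int[nu]_(y in E) f x y).
Proof.
move=> mD mE nuE mf f0.
pose m2 : {finite_measure set T2 -> \bar R} := mfrestr mE nuE.
pose g (x : T1 * T2) : \bar R := (((fun x => f x.1 x.2) \_ (D `*` E)) x)%:E.
have mg : measurable_fun setT g.
  apply/measurable_EFinP; apply/(measurable_restrictT _ _).1 => //.
  exact: measurableX.
have g0 x : (0 <= g x)%E.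
  rewrite lee_fin patchE; case: ifPn => // /set_mem[Dx Ey]; exact: f0.
have mF := measurable_fun_fubini_tonelli_F (m2 := m2) g mg g0.
apply: (@eq_measurable_fun _ _ _ _ D (fun x => fine (fubini_F m2 g x))); last first.
  apply: measurable_funTS; exact: measurableT_comp.
move=> x /set_mem Dx; rewrite /Rintegral; congr fine.
rewrite /fubini_F.
rewrite (@eq_measure_integral _ _ _ E m2 nu (fun y => (f x y)%:E)); last first.
  by move=> A mA AE; rewrite /m2 /= /mfrestr /mrestr setIidl.
rewrite [RHS]integral_mkcond; apply: eq_integral => y _.
rewrite /g !patchE.
have -> : ((x, y) \in D `*` E) = (y \in E).
  by apply/idP/idP => /set_mem; [move=> [_ Ey]|move=> Ey]; apply/mem_set.
by case: ifP.
Qed.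

End ParametricIntegral.

(** * The Hamiltonians *)

Section ScalarFunctions.
Context (R : realType).
Implicit Types x y r : R.

(* [phi1] and [phi2] are the coefficients of [p] and [q] in the jump integrand of
   [Hplus]; they are nonnegative, convex, and sum to [x ^+ 2]. *)
Definition phi1 x : R := pospart (1 + x) ^+ 2 - 1 - 2 * x.
Definition phi2 x : R := negpart (1 + x) ^+ 2.

Lemma posnegE x : (0 <= x /\ pospart x = x /\ negpart x = 0)
  \/ (x <= 0 /\ pospart x = 0 /\ negpart x = - x).
Proof.
have [x0|/ltW x0] := leP 0 x; [left|right]; rewrite /pospart /negpart.
  by rewrite (max_idPl x0) (max_idPr _)// oppr_le0.
by rewrite (max_idPr x0) (max_idPl _)// oppr_ge0.
Qed.

Lemma phi12_sqr x : phi1 x + phi2 x = x ^+ 2.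
Proof. by rewrite /phi1 /phi2; case: (posnegE (1 + x)) => -[? [-> ->]]; ring. Qed.

Lemma phi1_ge0 x : 0 <= phi1 x.
Proof. by rewrite /phi1; case: (posnegE (1 + x)) => -[? [-> _]]; nra. Qed.

Lemma phi2_ge0 x : 0 <= phi2 x.
Proof. exact: sqr_ge0. Qed.

Lemma phi1_0 : phi1 0 = 0.
Proof. by rewrite /phi1; case: (posnegE (1 + 0 : R)) => -[? [-> _]]; lra. Qed.

Lemma phi2_0 : phi2 0 = 0.
Proof. by rewrite /phi2; case: (posnegE (1 + 0 : R)) => -[? [_ ->]]; lra. Qed.

(** The square of a nonnegative convex function is convex; [z] stands for the function at the
    midpoint. *)
Lemma sqr_mid x y z : 0 <= z -> z <= (x + y) / 2 ->
  z ^+ 2 <= (x ^+ 2 + y ^+ 2) / 2.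
Proof.
move=> z0 zxy; apply: (@le_trans _ _ (((x + y) / 2) ^+ 2)).
  by rewrite lerXn2r// nnegrE (le_trans z0).
by have := sqr_ge0 (x - y); lra.
Qed.

Lemma phi1_mid x y : phi1 (2^-1 * (x + y)) <= (phi1 x + phi1 y) / 2.
Proof.
rewrite /phi1.
suff : pospart (1 + 2^-1 * (x + y)) ^+ 2
    <= (pospart (1 + x) ^+ 2 + pospart (1 + y) ^+ 2) / 2 by lra.
apply: sqr_mid; first by rewrite /pospart le_max lexx orbT.
case: (posnegE (1 + x)) => -[? [-> _]]; case: (posnegE (1 + y)) => -[? [-> _]];
by case: (posnegE (1 + 2^-1 * (x + y))) => -[? [-> _]]; lra.
Qed.

Lemma phi2_mid x y : phi2 (2^-1 * (x + y)) <= (phi2 x + phi2 y) / 2.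
Proof.
apply: sqr_mid; first by rewrite /negpart le_max lexx orbT.
case: (posnegE (1 + x)) => -[? [_ ->]]; case: (posnegE (1 + y)) => -[? [_ ->]];
by case: (posnegE (1 + 2^-1 * (x + y))) => -[? [_ ->]]; lra.
Qed.

Lemma sqr_lip r x y : `|x| <= r -> `|y| <= r ->
  `|x ^+ 2 - y ^+ 2| <= 2 * r * `|x - y|.
Proof.
move=> xr yr; rewrite subr_sqr normrM mulrC ler_wpM2r//.
by apply: le_trans (ler_normD _ _) _; lra.
Qed.

Lemma pospart_lip x y : `|pospart x - pospart y| <= `|x - y|.
Proof.
by apply: le_trans (ler_norm_max _ _ _ _) _; rewrite subrr normr0 addr0.
Qed.

Lemma negpart_lip x y : `|negpart x - negpart y| <= `|x - y|.
Proof.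
apply: le_trans (ler_norm_max _ _ _ _) _.
by rewrite subrr normr0 addr0 -opprD normrN.
Qed.

Lemma pospart_norm x : `|pospart x| <= `|x|.
Proof. by case: (posnegE x) => -[? [-> _]] //; rewrite normr0. Qed.

Lemma negpart_norm x : `|negpart x| <= `|x|.
Proof. by case: (posnegE x) => -[? [_ ->]]; rewrite ?normrN ?normr0. Qed.

Lemma norm_add1 r x : `|x| <= r -> `|1 + x| <= 1 + r.
Proof. by move=> xr; apply: le_trans (ler_normD _ _) _; rewrite normr1 lerD2l. Qed.

(** The natural constant [2 * (1 + r)] is enlarged to the one of [phi1], whose linear term adds
    [2]. *)
Lemma phi2_lip r x y : `|x| <= r -> `|y| <= r ->
  `|phi2 x - phi2 y| <= (4 + 2 * r) * `|x - y|.
Proof.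
move=> xr yr; rewrite /phi2.
have nr z : `|z| <= r -> `|negpart (1 + z)| <= 1 + r.
  by move=> zr; apply: le_trans (negpart_norm _) _; exact: norm_add1.
apply: le_trans (sqr_lip (nr _ xr) (nr _ yr)) _.
have r0 : 0 <= r by exact: le_trans xr.
apply: (@le_trans _ _ (2 * (1 + r) * `|x - y|)); last first.
  by rewrite ler_wpM2r//; lra.
rewrite ler_wpM2l//; first lra.
by apply: le_trans (negpart_lip _ _) _; rewrite [X in `|X|](_ : _ = x - y)//; ring.
Qed.

Lemma phi1_lip r x y : `|x| <= r -> `|y| <= r ->
  `|phi1 x - phi1 y| <= (4 + 2 * r) * `|x - y|.
Proof.
move=> xr yr; rewrite /phi1.
have nr z : `|z| <= r -> `|pospart (1 + z)| <= 1 + r.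
  by move=> zr; apply: le_trans (pospart_norm _) _; exact: norm_add1.
have -> : pospart (1 + x) ^+ 2 - 1 - 2 * x - (pospart (1 + y) ^+ 2 - 1 - 2 * y)
  = (pospart (1 + x) ^+ 2 - pospart (1 + y) ^+ 2) - 2 * (x - y) by ring.
apply: le_trans (ler_normB _ _) _.
rewrite (_ : (4 + 2 * r) * `|x - y| = 2 * (1 + r) * `|x - y| + 2 * `|x - y|); last ring.
apply: lerD; last by rewrite normrM ger0_norm.
apply: le_trans (sqr_lip (nr _ xr) (nr _ yr)) _.
have r0 : 0 <= r by exact: le_trans xr.
rewrite ler_wpM2l//; first lra.
by apply: le_trans (pospart_lip _ _) _; rewrite [X in `|X|](_ : _ = x - y)//; ring.
Qed.

Lemma measurable_phi1 : measurable_fun setT phi1.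
Proof.
apply: measurable_funB; last by apply: measurable_funM => //.
apply: measurable_funB => //; apply: measurable_funX; apply: measurable_maxr => //.
exact: measurable_funD.
Qed.

Lemma measurable_phi2 : measurable_fun setT phi2.
Proof.
apply: measurable_funX; apply: measurable_maxr => //.
by apply: measurableT_comp => //; exact: measurable_funD.
Qed.

End ScalarFunctions.

Section DotProduct.
Context (R : realType) (m : nat).
Implicit Types v w : 'cV[R]_m.

Lemma dotvE v w : dotv v w = \sum_(i < m) v i 0 * w i 0.
Proof. by rewrite /dotv mxE; apply: eq_bigr => i _; rewrite mxE. Qed.

Lemma dotvBl v v' w : dotv (v - v') w = dotv v w - dotv v' w.
Proof. by rewrite /dotv linearB mulmxBl !mxE. Qed.

Lemma dotvDl v v' w : dotv (v + v') w = dotv v w + dotv v' w.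
Proof. by rewrite /dotv linearD mulmxDl !mxE. Qed.

Lemma dotvZl a v w : dotv (a *: v) w = a * dotv v w.
Proof. by rewrite /dotv linearZ -scalemxAl !mxE. Qed.

Lemma dot0v w : dotv 0 w = 0.
Proof. by rewrite /dotv trmx0 mul0mx mxE. Qed.

Lemma dotvN v w : dotv v (- w) = - dotv v w.
Proof. by rewrite /dotv mulmxN mxE. Qed.

Lemma dotv_bound v w k : (forall i, `|w i 0| <= k) -> `|dotv v w| <= m%:R * k * `|v|.
Proof.
move=> wk; rewrite dotvE; apply: le_trans (ler_norm_sum _ _ _) _.
rewrite -mulrA mulr_natl -[X in _ *+ X]card_ord -sumr_const.
apply: ler_sum => i _; rewrite normrM mulrC; apply: ler_pM => //.
exact: ler_mx_norm_entry.
Qed.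

Lemma sqnormE n v (s : 'M[R]_(m, n)) :
  sqnorm (v^T *m s) = \sum_(k < n) dotv v (col k s) ^+ 2.
Proof.
apply: eq_bigr => k _; congr (_ ^+ 2); rewrite /dotv !mxE.
by apply: eq_bigr => i _; rewrite !mxE.
Qed.

(** The matrix norm is the maximum of the entries, hence below the Euclidean norm. The bound on
    [Sigma] thus gives coercivity in this norm with the same [del]. *)
Lemma le_sqr_norm_dotv v : `|v| ^+ 2 <= dotv v v.
Proof.
have dv0 : 0 <= dotv v v by rewrite dotvE; apply: sumr_ge0 => i _; rewrite -expr2 sqr_ge0.
rewrite -[leRHS]sqr_sqrtr// lerXn2r// ?nnegrE ?sqrtr_ge0//.
apply: mx_norm_le_entries => [|i j]; first exact: sqrtr_ge0.
rewrite -sqrtr_sqr ler_wsqrtr// dotvE (bigD1 i)//= (ord1 j) -expr2 lerDl.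
by apply: sumr_ge0 => h _; rewrite -expr2 sqr_ge0.
Qed.

End DotProduct.

(** * Jump integrals and the splitting of the Hamiltonian *)

Section Hamiltonian.
Context (R : realType) (m n l : nat).
Notation V := 'cV[R]_m.

(** One [k] bounds all coefficients, which makes every later constant independent of [t]. The
    conditions are invariant under a simultaneous change of sign of [mu] and [beta]. *)
Definition regular_coefficients (E : set (borel_rV R l))
    (nu : 'I_l -> {measure set (borel_rV R l) -> \bar R})
    (mu : R -> 'cV[R]_m) (sigma : R -> 'M[R]_(m, n))
    (beta : R -> borel_rV R l -> 'M[R]_(m, l)) (T del k : R) : Prop :=
  [/\ measurable E /\ (forall j, (nu j E < +oo)%E),
      [/\ forall i, measurable_fun `[0, T]%classic (fun t => mu t i 0),
          forall i j, measurable_fun `[0, T]%classic (fun t => sigma t i j) &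
          forall i j, measurable_fun (`[0, T]%classic `*` E)
            (fun x : R * borel_rV R l => beta x.1 x.2 i j)],
      [/\ forall t i, t \in `[0, T] -> `|mu t i 0| <= k,
          forall t i j, t \in `[0, T] -> `|sigma t i j| <= k &
          forall t e i j, t \in `[0, T] -> E e -> `|beta t e i j| <= k],
      0 < k /\ 0 < del &
      forall t, t \in `[0, T] -> sym_ge (Sigma E nu sigma beta t) del%:M].

Lemma regular_coefficientsN E nu mu sigma beta T del k :
  regular_coefficients E nu mu sigma beta T del k ->
  regular_coefficients E nu (fun t => - mu t) sigma (fun t e => - beta t e) T del k.
Proof.
move=> [H1 [H2 H3 H4] [H5 H6 H7] H8 H9]; split; [exact: H1| | |exact: H8|].
- split; [move=> i|exact: H3|move=> i j].
    rewrite (_ : (fun t => _) = (fun t => - (mu t i 0))); last first.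
      by apply/funext => t; rewrite mxE.
    exact: measurableT_comp (H2 i).
  rewrite (_ : (fun x => _) = (fun x => - beta x.1 x.2 i j)); last first.
    by apply/funext => x; rewrite mxE.
  exact: measurableT_comp (H4 i j).
- split; [move=> t i tT|exact: H6|move=> t e i j tT Ee]; rewrite mxE normrN.
    exact: H5.
  exact: H7.
- move=> t tT.
  suff -> : Sigma E nu sigma (fun t e => - beta t e) t = Sigma E nu sigma beta t.
    exact: H9.
  rewrite /Sigma; congr (_ + _).
  apply: eq_bigr => j _; apply/matrixP => i h; rewrite !mxE.
  apply: eq_Rintegral => e _; congr (fun_of_matrix _ i h).
  have -> : col j (- beta t e) = - col j (beta t e).
    by apply/matrixP => a b; rewrite !mxE.
  by rewrite linearN /= mulmxN mulNmx opprK.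
Qed.

Context (E : set (borel_rV R l)).
Context (nu : 'I_l -> {measure set (borel_rV R l) -> \bar R}).
Context (mu : R -> 'cV[R]_m) (sigma : R -> 'M[R]_(m, n)).
Context (beta : R -> borel_rV R l -> 'M[R]_(m, l)).

Definition jump_sum (phi : R -> R) (t : R) (v : V) : R :=
  \sum_(j < l) \int[nu j]_(e in E) phi (dotv v (col j (beta t e))).

Definition coefA (t : R) (v : V) : R :=
  sqnorm (v^T *m sigma t) + 2 * dotv v (mu t) + jump_sum (@phi1 R) t v.

Definition coefB (t : R) (v : V) : R := jump_sum (@phi2 R) t v.

Context (T del k : R).
Hypothesis reg : regular_coefficients E nu mu sigma beta T del k.

Lemma dot_beta_bound t e j v : t \in `[0, T] -> E e ->
  `|dotv v (col j (beta t e))| <= m%:R * k * `|v|.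
Proof.
by move=> tT Ee; have [_ _ [_ _ bk] _ _] := reg; apply: dotv_bound => i; rewrite mxE bk.
Qed.

Lemma dot_beta_measurable2 j v : measurable_fun (`[0, T]%classic `*` E)
  (fun x : R * borel_rV R l => dotv v (col j (beta x.1 x.2))).
Proof.
have [_ [_ _ mb] _ _ _] := reg.
rewrite (_ : (fun x => _) = (fun x : R * borel_rV R l =>
    \sum_(i < m) v i 0 * (col j (beta x.1 x.2)) i 0)); last first.
  by apply/funext => x; rewrite dotvE.
apply: measurable_sum => i.
rewrite (_ : (fun x => _) = (fun x => v i 0 * beta x.1 x.2 i j)); last first.
  by apply/funext => x; rewrite mxE.
by apply: measurable_funM => //; exact: mb.
Qed.

Lemma dot_beta_measurable t j v : t \in `[0, T] ->
  measurable_fun E (fun e => dotv v (col j (beta t e))).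
Proof.
move=> tT; have [[mE _] _ _ _ _] := reg.
have := @measurable_comp _ _ _ _ _ _ (`[0, T]%classic `*` E)
  (fun x : R * borel_rV R l => dotv v (col j (beta x.1 x.2))) E (pair t).
apply.
- by apply: measurableX => //.
- by move=> _ [e Ee <-]; split.
- exact: dot_beta_measurable2.
- exact: measurable_funTS.
Qed.

(** Since [v^T beta] is bounded on [E] and [nu j E] is finite, these conditions make the jump
    integrals converge, so that they can be split and scaled. *)
Definition tame (phi : R -> R) : Prop := measurable_fun setT phi /\
  forall r, exists N, forall x, `|x| <= r -> `|phi x| <= N.

Lemma tame_integrable phi t j v : tame phi -> t \in `[0, T] ->
  (nu j).-integrable E (EFin \o (fun e => phi (dotv v (col j (beta t e))))).
Proof.
move=> [mphi bphi] tT; have [[mE nuE] _ _ _ _] := reg.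
apply: measurable_bounded_integrable => //.
  by apply: measurableT_comp => //; exact: dot_beta_measurable.
have [N HN] := bphi (m%:R * k * `|v|).
by apply: (@bounded_near_cst _ _ _ _ _ N) => e Ee; apply: HN; exact: dot_beta_bound.
Qed.

Lemma lip_tame (phi L : R -> R) : measurable_fun setT phi ->
  (forall r x y, `|x| <= r -> `|y| <= r -> `|phi x - phi y| <= L r * `|x - y|) ->
  tame phi.
Proof.
move=> mphi lphi; split => // r; exists (`|phi 0| + `|L r| * r) => x xr.
have r0 : 0 <= r by exact: le_trans xr.
rewrite -[phi x](subrK (phi 0)) addrC; apply: le_trans (ler_normD _ _) _.
rewrite lerD2l; apply: le_trans (lphi r x 0 xr _) _; first by rewrite normr0.
rewrite subr0; apply: le_trans (_ : `|L r| * `|x| <= _).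
  by rewrite ler_wpM2r// ler_norm.
by rewrite ler_wpM2l.
Qed.

Lemma tame_phi1 : tame (@phi1 R).
Proof. exact: lip_tame (@measurable_phi1 R) (@phi1_lip R). Qed.

Lemma tame_phi2 : tame (@phi2 R).
Proof. exact: lip_tame (@measurable_phi2 R) (@phi2_lip R). Qed.

Lemma tameZ a f : tame f -> tame (fun x => a * f x).
Proof.
move=> [mf bf]; split; first exact: measurable_funM.
move=> r; have [N HN] := bf r; exists (`|a| * N) => x xr.
by rewrite normrM ler_wpM2l// HN.
Qed.

Lemma jump_sumD f g t v : tame f -> tame g -> t \in `[0, T] ->
  jump_sum (fun x => f x + g x) t v = jump_sum f t v + jump_sum g t v.
Proof.
move=> tf tg tT; have [[mE _] _ _ _ _] := reg.
rewrite /jump_sum -big_split; apply: eq_bigr => j _.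
by rewrite RintegralD//; exact: tame_integrable.
Qed.

Lemma jump_sumZ a f t v : tame f -> t \in `[0, T] ->
  jump_sum (fun x => a * f x) t v = a * jump_sum f t v.
Proof.
move=> tf tT; have [[mE _] _ _ _ _] := reg.
rewrite /jump_sum mulr_sumr; apply: eq_bigr => j _.
by rewrite RintegralZl//; exact: tame_integrable.
Qed.

Lemma jump_sum_ge0 f t v : (forall x, 0 <= f x) -> 0 <= jump_sum f t v.
Proof. by move=> f0; apply: sumr_ge0 => j _; apply: Rintegral_ge0. Qed.

Lemma jump_sum0 f t : f 0 = 0 -> jump_sum f t 0 = 0.
Proof.
move=> f0; apply: big1 => j _.
under eq_Rintegral do rewrite dot0v f0.
by rewrite /Rintegral integral0.
Qed.

Lemma jump_sum_mid f t v w : tame f -> t \in `[0, T] ->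
  (forall x y, f (2^-1 * (x + y)) <= (f x + f y) / 2) ->
  jump_sum f t (2^-1 *: (v + w)) <= (jump_sum f t v + jump_sum f t w) / 2.
Proof.
move=> tf tT fmid; have [[mE _] _ _ _ _] := reg.
rewrite /jump_sum -big_split/= mulr_suml; apply: ler_sum => j _.
have iv := tame_integrable j v tf tT; have iw := tame_integrable j w tf tT.
rewrite -RintegralD// -RintegralZr//; last first.
  by have := integrableD mE iv iw; apply: eq_integrable => // e _; rewrite /= EFinD.
apply: le_Rintegral => //; first exact: tame_integrable.
  by have := integrableZr mE (2^-1) (integrableD mE iv iw);
    apply: eq_integrable => // e _; rewrite /= EFinM EFinD.
by move=> e _; rewrite dotvZl dotvDl; exact: fmid.
Qed.

Lemma jump_sum_lip (f L : R -> R) : measurable_fun setT f ->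
  (forall r x y, `|x| <= r -> `|y| <= r -> `|f x - f y| <= L r * `|x - y|) ->
  (forall r, 0 <= r -> 0 <= L r) ->
  forall t, t \in `[0, T] -> locally_lipschitz (jump_sum f t)
    (fun r => \sum_(j < l) L (m%:R * k * r) * (m%:R * k) * fine (nu j E)).
Proof.
move=> mf fL L0 t tT r v w vr wr; have [[mE nuE] _ _ [k0 _] _] := reg.
have tf : tame f by exact: lip_tame fL.
rewrite /jump_sum -sumrB; apply: le_trans (ler_norm_sum _ _ _) _.
rewrite mulr_suml; apply: ler_sum => j _.
have iv := tame_integrable j v tf tT; have iw := tame_integrable j w tf tT.
have ivw : (nu j).-integrable E (EFin \o (fun e =>
    f (dotv v (col j (beta t e))) - f (dotv w (col j (beta t e))))).
  by have := integrableB mE iv iw; apply: eq_integrable => // e _; rewrite /= EFinB.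
rewrite -RintegralB//; apply: le_trans (le_normr_Rintegral mE ivw) _.
rewrite [leRHS]mulrAC -Rintegral_cst//; apply: le_Rintegral => //.
- exact: integrable_norm.
- apply: measurable_bounded_integrable => //.
  exact: (@bounded_near_cst _ _ _ _ _ `|L (m%:R * k * r) * (m%:R * k) * `|v - w| |).
have mk0 : 0 <= m%:R * k by rewrite mulr_ge0// ltW.
have dr z e : E e -> `|z| <= r -> `|dotv z (col j (beta t e))| <= m%:R * k * r.
  by move=> Ee zr; apply: le_trans (dot_beta_bound _ _ _ _) _ => //; rewrite ler_wpM2l.
move=> e Ee; apply: le_trans (fL _ _ _ (dr _ _ Ee vr) (dr _ _ Ee wr)) _.
rewrite -[leRHS]mulrA ler_wpM2l//.
  by apply: L0; rewrite mulr_ge0// (le_trans _ vr).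
by rewrite -dotvBl; exact: dot_beta_bound.
Qed.

Lemma measurable_jump_sum f v : tame f -> (forall x, 0 <= f x) ->
  measurable_fun `[0, T]%classic (jump_sum f ^~ v).
Proof.
move=> [mf _] f0; have [[mE nuE] _ _ _ _] := reg.
apply: measurable_sum => j.
apply: (@measurable_fun_Rintegral_param R _ _ _ _ (nu j) `[0, T]%classic E
  (fun t e => f (dotv v (col j (beta t e))))) => //.
by apply: measurableT_comp => //; exact: dot_beta_measurable2.
Qed.

Lemma HplusE t v p q : t \in `[0, T] ->
  Hplus E nu mu sigma beta t v p q = p * coefA t v + q * coefB t v.
Proof.
move=> tT.
have -> : p * coefA t v + q * coefB t v = p * sqnorm (v^T *m sigma t)
  + 2 * p * dotv v (mu t)
  + (p * jump_sum (@phi1 R) t v + q * jump_sum (@phi2 R) t v).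
  by rewrite /coefA /coefB; ring.
rewrite -!jump_sumZ -?jump_sumD//; try exact: tameZ tame_phi1;
  try exact: tameZ tame_phi2; try exact: tame_phi1; exact: tame_phi2.
Qed.

End Hamiltonian.

Section SumIntegral.
Context d (X : measurableType d) (R : realType) (nu : {measure set X -> \bar R}).

Lemma Rintegral_sum (D : set X) (I : Type) (s : seq I) (f : I -> X -> R) :
  measurable D -> (forall i, nu.-integrable D (EFin \o f i)) ->
  \int[nu]_(x in D) (\sum_(i <- s) f i x) = \sum_(i <- s) \int[nu]_(x in D) f i x.
Proof.
move=> mD fi; elim: s => [|i s IH].
  rewrite big_nil; under eq_Rintegral do rewrite big_nil.
  by rewrite /Rintegral integral0.
rewrite big_cons -IH -RintegralD//.
  by under eq_Rintegral do rewrite big_cons.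
have := integrable_sum mD s (P := xpredT) (h := fun i => EFin \o f i) (fun i _ => fi i).
by apply: eq_integrable => // x _ /=; rewrite -sumEFin.
Qed.

End SumIntegral.

Section QuadraticForm.
Context (R : realType) (m : nat) (M : 'M[R]_m).
Implicit Types v w : 'cV[R]_m.

(** The cross terms enter through the sum [b v w + b w v], with opposite signs in [f (v + w)] and
    [f (v - w)]. *)
Lemma quadratic_parallelogram v w (f := fun u => (u^T *m M *m u) 0 0) :
  f (2^-1 *: (v + w)) + f (v - w) / 4 = (f v + f w) / 2.
Proof.
pose b (u u' : 'cV[R]_m) : R := (u^T *m M *m u') 0 0.
have bD (u1 u2 : 'cV[R]_m) : f (u1 + u2) = f u1 + f u2 + (b u1 u2 + b u2 u1).
  rewrite /f /b; have -> : (u1 + u2)^T = u1^T + u2^T by rewrite linearD.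
  by rewrite !mulmxDl !mulmxDr !mxE; ring.
have bN (u1 u2 : 'cV[R]_m) : f (u1 - u2) = f u1 + f u2 - (b u1 u2 + b u2 u1).
  rewrite /f /b; have -> : (u1 - u2)^T = u1^T - u2^T by rewrite linearB.
  by rewrite !mulmxBl !mulmxBr !mxE; ring.
have fZ a (u : 'cV[R]_m) : f (a *: u) = a ^+ 2 * f u.
  rewrite /f; have -> : (a *: u)^T = a *: u^T by rewrite linearZ.
  by rewrite -!scalemxAl -scalemxAr !mxE; ring.
by rewrite fZ bD bN; field.
Qed.

End QuadraticForm.

(** * Coercivity, strong convexity and Lipschitz bounds *)

Section RegularHamiltonian.
Context (R : realType) (m n l : nat).
Notation V := 'cV[R]_m.
Context (E : set (borel_rV R l)).
Context (nu : 'I_l -> {measure set (borel_rV R l) -> \bar R}).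
Context (mu : R -> 'cV[R]_m) (sigma : R -> 'M[R]_(m, n)).
Context (beta : R -> borel_rV R l -> 'M[R]_(m, l)).
Context (T del k : R).
Hypothesis reg : regular_coefficients E nu mu sigma beta T del k.
Notation Hp := (Hplus E nu mu sigma beta).
Notation A := (coefA E nu mu sigma beta).
Notation B := (coefB E nu beta).

(** Both sides expand into a sum over pairs of indices, which is exchanged with the integral;
    bounded [beta] and finite [nu j E] make each term integrable. *)
Lemma Sigma_form t v : t \in `[0, T] ->
  (v^T *m Sigma E nu sigma beta t *m v) 0 0
  = sqnorm (v^T *m sigma t) + jump_sum E nu beta (fun x => x ^+ 2) t v.
Proof.
move=> tT; have [[mE nuE] [_ _ mb] [_ _ bk] _ _] := reg.
rewrite /Sigma mulmxDr mulmxDl mxE; congr (_ + _).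
  rewrite mulmxA -(mulmxA (v^T *m _)).
  rewrite (_ : (sigma t)^T *m v = (v^T *m sigma t)^T); last by rewrite trmx_mul trmxK.
  rewrite mxE.
  by apply: eq_bigr => i _; rewrite [in X in _ * X]mxE expr2.
rewrite mulmx_sumr mulmx_suml summxE; apply: eq_bigr => j _.
pose f (ih : 'I_m * 'I_m) e :=
  v ih.1 0 * v ih.2 0 * (col j (beta t e) *m (col j (beta t e))^T) ih.1 ih.2.
have outer e i h : (col j (beta t e) *m (col j (beta t e))^T) i h
    = beta t e i j * beta t e h j.
  by rewrite mxE big_ord1 !mxE.
have mbt i : measurable_fun E (fun e => beta t e i j).
  have := @measurable_comp _ _ _ _ _ _ (`[0, T]%classic `*` E)
    (fun x : R * borel_rV R l => beta x.1 x.2 i j) E (pair t); apply.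
  - exact: measurableX.
  - by move=> _ [e Ee <-]; split.
  - exact: mb.
  - exact: measurable_funTS.
have gint i h : (nu j).-integrable E
    (EFin \o (fun e => (col j (beta t e) *m (col j (beta t e))^T) i h)).
  apply: measurable_bounded_integrable => //.
    rewrite (_ : (fun e => _) = (fun e => beta t e i j * beta t e h j)).
      exact: measurable_funM.
    by apply/funext => e; rewrite outer.
  apply: (@bounded_near_cst _ _ _ _ _ (k * k)) => e Ee.
  by rewrite outer normrM; apply: ler_pM => //; exact: bk.
have fint ih : (nu j).-integrable E (EFin \o f ih).
  have := integrableZl mE (v ih.1 0 * v ih.2 0) (gint ih.1 ih.2).
  by apply: eq_integrable => // e _; rewrite /= /f EFinM.
transitivity (\sum_(ih : 'I_m * 'I_m) \int[nu j]_(e in E) f ih e).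
  rewrite mxE.
  rewrite -(pair_big xpredT xpredT (fun i h => \int[nu j]_(e in E) f (i, h) e))/=.
  rewrite exchange_big/=; apply: eq_bigr => h _; rewrite mxE mulr_suml.
  apply: eq_bigr => i _; rewrite !mxE.
  rewrite /f /= RintegralZl//; last exact: gint.
  by rewrite -!mulrA; congr (_ * _); rewrite mulrC.
rewrite -(@Rintegral_sum _ _ _ (nu j) E _ _ f mE fint); apply: eq_Rintegral => e _.
rewrite -(pair_big xpredT xpredT (fun i h => f (i, h) e))/= expr2 dotvE mulr_suml.
apply: eq_bigr => i _; rewrite mulr_sumr; apply: eq_bigr => h _.
by rewrite /f /= outer !mxE; ring.
Qed.

(** [m * k] bounds the drift term relative to [|v|]; the added [1] makes the constant positive. *)
Definition coef_slope : R := m%:R * k + 1.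

(** The three summands come from the diffusion, the drift and the jumps; [m * k * r] bounds each dot
    product on the ball of radius [r]. *)
Definition coef_lipschitz (r : R) : R :=
  n%:R * (2 * (m%:R * k * r) * (m%:R * k)) + 2 * (m%:R * k) +
  \sum_(j < l) (4 + 2 * (m%:R * k * r)) * (m%:R * k) * fine (nu j E).

Let mk_ge0 : 0 <= m%:R * k.
Proof. by have [_ _ _ [k0 _] _] := reg; rewrite mulr_ge0// ltW. Qed.

Lemma coef_slope_gt0 : 0 < coef_slope.
Proof. by rewrite /coef_slope ltr_wpDl. Qed.

Lemma coef_locally_lipschitz t : t \in `[0, T] ->
  locally_lipschitz (A t) coef_lipschitz /\ locally_lipschitz (B t) coef_lipschitz.
Proof.
move=> tT; have [_ _ [muk sk _] [k0 _] _] := reg.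
have pos r : 0 <= r -> 0 <= 4 + 2 * r :> R by move=> r0; lra.
have J1 := jump_sum_lip reg (@measurable_phi1 R) (@phi1_lip R) pos tT.
have J2 := jump_sum_lip reg (@measurable_phi2 R) (@phi2_lip R) pos tT.
have mk0 := mk_ge0; split=> r v w vr wr; have r0 : 0 <= r by exact: le_trans vr.
- rewrite /coefA /coef_lipschitz.
  set JL := \sum_(j < l) _.
  have -> : sqnorm (v^T *m sigma t) + 2 * dotv v (mu t) + jump_sum E nu beta (@phi1 R) t v
    - (sqnorm (w^T *m sigma t) + 2 * dotv w (mu t) + jump_sum E nu beta (@phi1 R) t w)
    = (sqnorm (v^T *m sigma t) - sqnorm (w^T *m sigma t)) + 2 * dotv (v - w) (mu t)
      + (jump_sum E nu beta (@phi1 R) t v - jump_sum E nu beta (@phi1 R) t w).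
    by rewrite dotvBl; ring.
  rewrite [leRHS]mulrDl; apply: le_trans (ler_normD _ _) _; apply: lerD; last exact: J1.
  rewrite [leRHS]mulrDl; apply: le_trans (ler_normD _ _) _; apply: lerD; last first.
    rewrite normrM ger0_norm// -[leRHS]mulrA ler_wpM2l//; apply: dotv_bound => i; exact: muk.
  rewrite !sqnormE -sumrB; apply: le_trans (ler_norm_sum _ _ _) _.
  rewrite -mulrA mulr_natl -[X in _ *+ X]card_ord -sumr_const.
  apply: ler_sum => i _.
  have dk u : `|dotv u (col i (sigma t))| <= m%:R * k * `|u|.
    by apply: dotv_bound => h; rewrite mxE sk.
  have dr u : `|u| <= r -> `|dotv u (col i (sigma t))| <= m%:R * k * r.
    by move=> ur; apply: le_trans (dk u) _; rewrite ler_wpM2l.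
  apply: le_trans (sqr_lip (dr _ vr) (dr _ wr)) _.
  rewrite -[leRHS]mulrA ler_wpM2l//; last by rewrite -dotvBl.
  by rewrite !mulr_ge0// ltW.
- apply: le_trans (J2 r v w vr wr) _; rewrite ler_wpM2r// lerDr.
  by apply: addr_ge0; rewrite !mulr_ge0// ltW.
Qed.

(** Without drift, [A] becomes [A0] with [A0 + B] the quadratic form of [Sigma]. If [p <= q], then
    [p * A0 + q * B = p * (A0 + B) + (q - p) * B]: the first term gives coercivity and, by the
    parallelogram identity, the convexity gap; the second is nonnegative and convex. If [q <= p],
    the excess is carried by [A0]. The drift is linear and leaves the gap unchanged. *)
Lemma coef_pair t : t \in `[0, T] ->
  strongly_convex_pair del coef_slope coef_lipschitz (A t) (B t).
Proof.
move=> tT; have [_ _ [muk _ _] [k0 d0] Sdel] := reg.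
pose f (u : V) : R := (u^T *m Sigma E nu sigma beta t *m u) 0 0.
pose A0 v := sqnorm (v^T *m sigma t) + jump_sum E nu beta (@phi1 R) t v.
have AE v : A t v = A0 v + 2 * dotv v (mu t) by rewrite /A0 /coefA; ring.
have fE v : f v = A0 v + B t v.
  rewrite /f Sigma_form// /A0 /coefB -addrA -(jump_sumD reg)//; first last.
  - exact: tame_phi2.
  - exact: tame_phi1.
  congr (_ + _); apply: eq_bigr => j _.
  by under [RHS]eq_Rintegral do rewrite phi12_sqr.
have sq0 v : 0 <= sqnorm (v^T *m sigma t) by apply: sumr_ge0 => i _; exact: sqr_ge0.
have A00 v : 0 <= A0 v by rewrite addr_ge0// jump_sum_ge0//; exact: phi1_ge0.
have B00 v : 0 <= B t v by apply: jump_sum_ge0; exact: phi2_ge0.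
have fdel v : del * `|v| ^+ 2 <= f v.
  have := Sdel t tT v; rewrite /f mul_mx_scalar -scalemxAl mxE => /(le_trans _); apply.
  by rewrite ler_pM2l//; exact: le_sqr_norm_dotv.
have fmid v w : f (2^-1 *: (v + w)) + f (v - w) / 4 = (f v + f w) / 2.
  exact: quadratic_parallelogram.
have Amid v w : A0 (2^-1 *: (v + w)) <= (A0 v + A0 w) / 2.
  have := jump_sum_mid reg v w (tame_phi1 R) tT (@phi1_mid R).
  have : sqnorm ((2^-1 *: (v + w))^T *m sigma t)
      <= (sqnorm (v^T *m sigma t) + sqnorm (w^T *m sigma t)) / 2.
    rewrite !sqnormE -big_split/= mulr_suml; apply: ler_sum => i _.
    rewrite dotvZl dotvDl; move: (dotv v _) (dotv w _) => a c.
    by have := sqr_ge0 (a - c); lra.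
  by rewrite /A0; lra.
have Bmid v w : B t (2^-1 *: (v + w)) <= (B t v + B t w) / 2.
  exact: (jump_sum_mid reg v w (tame_phi2 R) tT (@phi2_mid R)).
split.
- split; last exact/jump_sum0/phi2_0.
  rewrite /coefA trmx0 mul0mx dot0v jump_sum0 ?phi1_0// mulr0 !addr0.
  by apply: big1 => i _; rewrite mxE expr0n.
- exact: coef_locally_lipschitz.
- move=> p q v p0 q0; rewrite AE.
  have dv : - (coef_slope * `|v|) <= dotv v (mu t).
    rewrite lerNl; apply: le_trans (ler_norm _) _; rewrite normrN.
    apply: le_trans (dotv_bound v (k := k) _) _; first by move=> i; exact: muk.
    by rewrite ler_wpM2r// lerDl.
  have := fdel v; have := A00 v; have := B00 v; rewrite fE => Bv Av fv.
  have pd := ler_wpM2l (ltW p0) dv.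
  have [pq|/ltW qp] := leP p q.
    have := ler_wpM2l (ltW p0) fv.
    have : 0 <= (q - p) * B t v by rewrite mulr_ge0// subr_ge0.
    by lra.
  have := ler_wpM2l (ltW q0) fv.
  have : 0 <= (p - q) * A0 v by rewrite mulr_ge0// subr_ge0.
  by lra.
- move=> p q v w p0 q0; rewrite !AE !dotvZl dotvDl.
  have := fmid v w; have := fdel (v - w); have := Amid v w; have := Bmid v w.
  rewrite !fE; move: (dotv v _) (dotv w _) (`|v - w| ^+ 2) => dv dw d2.
  move: (A0 _) (B t _) (A0 (v - w)) (B t (v - w)) => Au Bu Avw Bvw.
  move: (A0 v) (A0 w) (B t v) (B t w) => Av Aw Bv Bw Bmu Amu fvw fm.
  have [pq|/ltW qp] := leP p q.
    have := ler_wpM2l (ltW p0) fvw.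
    have := congr1 (fun x => p * x) fm.
    have : 0 <= (q - p) * ((Bv + Bw) / 2 - Bu).
      by rewrite mulr_ge0// subr_ge0.
    by lra.
  have := ler_wpM2l (ltW q0) fvw.
  have := congr1 (fun x => q * x) fm.
  have : 0 <= (p - q) * ((Av + Aw) / 2 - Au).
    by rewrite mulr_ge0// subr_ge0.
  by lra.
Qed.

End RegularHamiltonian.

(** * Reduction of [Hminus] to [Hplus], and bounded minimizers *)

Section HamiltonianMinimum.
Context (R : realType) (m n l : nat).
Notation V := 'cV[R]_m.
Notation orthant := (@nonneg_vec R m).
Context (E : set (borel_rV R l)).
Context (nu : 'I_l -> {measure set (borel_rV R l) -> \bar R}).
Context (sigma : R -> 'M[R]_(m, n)).
Implicit Types (mu : R -> 'cV[R]_m) (beta : R -> borel_rV R l -> 'M[R]_(m, l)).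
Context (T del k : R).
Notation regular mu beta := (regular_coefficients E nu mu sigma beta T del k).

(* Changing the signs of [mu] and [beta] preserves all the assumptions that are
   used below, so that only [Hplus] has to be studied. *)
Lemma HminusE mu beta t v p q : Hminus E nu mu sigma beta t v p q
  = Hplus E nu (fun t => - mu t) sigma (fun t e => - beta t e) t v q p.
Proof.
rewrite /Hminus /Hplus dotvN mulrN; congr (_ + _); apply: eq_bigr => j _.
apply: eq_Rintegral => e _.
have -> : col j (- beta t e) = - col j (beta t e).
  by apply/matrixP => a b; rewrite !mxE.
by rewrite dotvN /= mulrN opprK.
Qed.

Lemma Hminus_starE mu beta t p q : Hminus_star E nu mu sigma beta t p q
  = Hplus_star E nu (fun t => - mu t) sigma (fun t e => - beta t e) t q p.
Proof.
by congr inf; apply: eq_imagel => v _; exact: HminusE.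
Qed.

Lemma Hplus_starE mu beta t p q : regular mu beta -> t \in `[0, T] ->
  Hplus_star E nu mu sigma beta t p q
  = min_value (coefA E nu mu sigma beta t) (coefB E nu beta t) p q.
Proof.
by move=> reg tT; congr inf; apply: eq_imagel => v _; exact: (HplusE reg).
Qed.

Lemma measurable_coefA mu beta v : regular mu beta ->
  measurable_fun `[0, T]%classic ((coefA E nu mu sigma beta)^~ v).
Proof.
move=> reg; have [_ [mmu ms _] _ _ _] := reg.
apply: measurable_funD; last first.
  exact: (measurable_jump_sum reg) (tame_phi1 R) (@phi1_ge0 R).
apply: measurable_funD.
  rewrite (_ : (fun t => _) =
      (fun t => \sum_(h < n) (\sum_(i < m) v i 0 * sigma t i h) ^+ 2)); last first.
    apply/funext => t; rewrite sqnormE; apply: eq_bigr => h _.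
    by rewrite dotvE; congr (_ ^+ 2); apply: eq_bigr => i _; rewrite mxE.
  apply: measurable_sum => h; apply: measurable_funX; apply: measurable_sum => i.
  by apply: measurable_funM => //; exact: ms.
apply: measurable_funM => //.
rewrite (_ : (fun t => _) = (fun t => \sum_(i < m) v i 0 * mu t i 0)); last first.
  by apply/funext => t; rewrite dotvE.
by apply: measurable_sum => i; apply: measurable_funM => //; exact: mmu.
Qed.

Lemma measurable_coefB mu beta v : regular mu beta ->
  measurable_fun `[0, T]%classic ((coefB E nu beta)^~ v).
Proof.
move=> reg; exact: (measurable_jump_sum reg) (tame_phi2 R) (@phi2_ge0 R).
Qed.

Lemma argmin_Hplus mu beta (c : R) (p q : R -> R) : regular mu beta -> 0 < c ->
  (forall t, t \in `[0, T] -> c <= p t <= 1 /\ c <= q t <= 1) ->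
  exists vhat : R -> V,
    (forall t, t \in `[0, T] ->
       argmin orthant (fun v => Hplus E nu mu sigma beta t v (p t) (q t))
       = [set vhat t]) /\
    [bounded vhat t | t in `[0, T]%classic].
Proof.
move=> reg c0 pq; have [_ _ _ [k0 d0] _] := reg.
have K0 : 0 < coef_slope m k := coef_slope_gt0 reg.
have /choice[vhat vP] : forall t, exists v, t \in `[0, T] -> [/\ orthant v,
    forall w, orthant w -> Hplus E nu mu sigma beta t v (p t) (q t)
      <= Hplus E nu mu sigma beta t w (p t) (q t) &
    `|v| <= 2 * coef_slope m k / (c * del)].
  move=> t; have [tT|] := boolP (t \in `[0, T]); last by exists 0.
  have [pc qc] := pq t tT; have gt0 x : c <= x <= 1 -> 0 < x.
    by case/andP => /(lt_le_trans c0).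
  have [v [ov vmin vr]] := minimizer_exists d0 K0 (coef_pair reg tT) (gt0 _ pc) (gt0 _ qc).
  exists v => _; split => //.
    by move=> w ow; rewrite !(HplusE reg)//; exact: vmin.
  exact: le_trans vr (minimizer_bound d0 K0 c0 pc qc).
exists vhat; split; last first.
  apply: (@bounded_near_cst _ _ _ _ _ (2 * coef_slope m k / (c * del))) => t tT.
  by have [_ _] := vP t tT.
move=> t tT; have [ov vmin _] := vP t tT; have [pc qc] := pq t tT.
have gt0 x : c <= x <= 1 -> 0 < x by case/andP => /(lt_le_trans c0).
apply/seteqP; split => [w [ow wmin]|w ->]; last by split.
apply: (minimizer_unique d0 (coef_pair reg tT) (gt0 _ pc) (gt0 _ qc)) => //.
  by move=> u ou; have := wmin u ou; rewrite !(HplusE reg).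
by move=> u ou; have := vmin u ou; rewrite !(HplusE reg).
Qed.

End HamiltonianMinimum.

(** * Uniform constants from the standing assumptions *)

Section StandingAssumptions.
Context (R : realType).

Lemma bounded_family (I : finType) (X : Type) (D : set X) (f : I -> X -> R) :
  (forall i, [bounded f i x | x in D]) ->
  exists2 k, 0 < k & forall i x, D x -> `|f i x| <= k.
Proof.
move=> bf.
have /choice[M HM] : forall i, exists M, forall x, D x -> `|f i x| <= M.
  (* Boundedness provides a number all of whose strict upper bounds bound [f]; hence [N + 1]. *)
  move=> i; have [N [_ HN]] := bf i; exists (N + 1); apply: HN.
  by rewrite ltrDl.
exists (1 + \sum_i `|M i|); first by rewrite ltr_wpDr// sumr_ge0.
move=> i x Dx; apply: le_trans (HM i x Dx) _; apply: le_trans (ler_norm _) _.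
by rewrite (bigD1 i)//= addrCA lerDl addr_ge0// sumr_ge0.
Qed.

Lemma standing_regular (m n l : nat) (T : R) (E : set (borel_rV R l))
    (nu : 'I_l -> {measure set (borel_rV R l) -> \bar R})
    (mu : R -> 'cV[R]_m) (sigma : R -> 'M[R]_(m, n))
    (beta : R -> borel_rV R l -> 'M[R]_(m, l)) :
  standing_assumptions E nu mu sigma beta T ->
  exists del k, regular_coefficients E nu mu sigma beta T del k.
Proof.
case=> _ [mE _ _ nuE] [mmu bmu ms bs] [mb bb _] [[del d0 Sdel] _].
have [k1 k10 Hk1] := bounded_family bmu.
have [k2 k20 Hk2] := @bounded_family _ _ _ (fun ih t => sigma t ih.1 ih.2)
  (fun ih => bs ih.1 ih.2).
have [k3 k30 Hk3] := @bounded_family _ _ _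
  (fun ij (x : R * borel_rV R l) => beta x.1 x.2 ij.1 ij.2) (fun ij => bb ij.1 ij.2).
exists del, (k1 + k2 + k3); split => //.
- split => // j; apply: le_lt_trans nuE; rewrite (bigD1 j)//= leeDl// sume_ge0//.
- split.
  + by move=> t i tT; apply: le_trans (Hk1 i t tT) _; lra.
  + by move=> t i j tT; apply: le_trans (Hk2 (i, j) t tT) _; lra.
  + move=> t e i j tT Ee; apply: le_trans (Hk3 (i, j) (t, e) _) _; last lra.
    by split.
- by split => //; lra.
Qed.

End StandingAssumptions.

Unset Implicit Arguments.

Theorem theorem3p3 (R : realType) (m n l : nat) (T : R)
    (E : set (borel_rV R l))
    (nu : 'I_l -> {measure set (borel_rV R l) -> \bar R})
    (mu : R -> 'cV[R]_m) (sigma : R -> 'M[R]_(m, n))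
    (beta : R -> borel_rV R l -> 'M[R]_(m, l)) :
  standing_assumptions E nu mu sigma beta T ->
  exists P : (R -> R) * (R -> R),
    [/\ positive_solution E nu mu sigma beta T P,
        (forall Q : (R -> R) * (R -> R),
           positive_solution E nu mu sigma beta T Q ->
           forall t, t \in `[0, T] -> Q.1 t = P.1 t /\ Q.2 t = P.2 t),
        (exists vplus : R -> 'cV[R]_m,
           (forall t, t \in `[0, T] ->
              argmin (@nonneg_vec R m)
                (fun v => Hplus E nu mu sigma beta t v (P.1 t) (P.2 t))
              = [set vplus t]) /\
           [bounded vplus t | t in `[0, T]%classic]) &
        (exists vminus : R -> 'cV[R]_m,
           (forall t, t \in `[0, T] ->
              argmin (@nonneg_vec R m)
                (fun v => Hminus E nu mu sigma beta t v (P.1 t) (P.2 t))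
              = [set vminus t]) /\
           [bounded vminus t | t in `[0, T]%classic])].
Proof.
move=> sa; have [[T0 _ _ _] _ _ _ _] := sa.
have [del [k regp]] := standing_regular sa.
have regm := regular_coefficientsN regp.
have [_ _ _ [k0 d0] _] := regp.
(* For [false] the coefficients change sign. As [F] takes the component's own value first, the
   arguments of [Hminus_star] appear swapped in [FmE]. *)
pose F (b : bool) t := if b
  then min_value (coefA E nu mu sigma beta t) (coefB E nu beta t)
  else min_value
    (coefA E nu (fun t => - mu t) sigma (fun t e => - beta t e) t)
    (coefB E nu (fun t e => - beta t e) t).
have FpE t p q : t \in `[0, T] -> Hplus_star E nu mu sigma beta t p q = F true t p q.
  by move=> tT; rewrite (Hplus_starE _ _ regp tT).
have FmE t p q : t \in `[0, T] -> Hminus_star E nu mu sigma beta t p q = F false t q p.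
  by move=> tT; rewrite Hminus_starE (Hplus_starE _ _ regm tT).
pose sel (P : (R -> R) * (R -> R)) (b : bool) := if b then P.1 else P.2.
have solE (P : (R -> R) * (R -> R)) :
    positive_solution E nu mu sigma beta T P <-> coupled_solution T F (sel P).
  split.
    case=> -[ac1 ac2] d1 d2 [e1 e2] P0; split.
    - by case.
    - case; [apply: ae_impl d1 | apply: ae_impl d2] => t + tT => /(_ tT).
        by rewrite FpE.
      by rewrite FmE.
    - by case.
    - by case=> t /P0[].
  case=> ac d e P0; split.
  - by split; [exact: (ac true)|exact: (ac false)].
  - by have := d true; apply: ae_impl => t + tT => /(_ tT); rewrite FpE.
  - by have := d false; apply: ae_impl => t + tT => /(_ tT); rewrite FmE.
  - by split; [exact: (e true)|exact: (e false)].
  - by move=> t tT; split; [exact: (P0 true)|exact: (P0 false)].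
pose K := coef_slope m k; have K0 : 0 < K := coef_slope_gt0 regp.
pose C := K ^+ 2 / del; have C0 : 0 < C by rewrite divr_gt0// exprn_gt0.
pose c := expR (C * (0 - T)); have c0 : 0 < c by exact: expR_gt0.
pose r := 2 * K / (c * del).
have r0 : 0 <= r by rewrite divr_ge0// mulr_ge0// ltW.
pose Lam := coef_lipschitz m n E nu k.
(* [|Lam r| * r] bounds both coefficients on the ball containing all minimizers; [1] is added for
   positivity. *)
pose N := `|Lam r| * r + 1.
have N0 : 0 < N by rewrite ltr_wpDl// mulr_ge0.
(* [K] and [Lam] depend on the coefficients only through [k] and the masses [nu j E], so both
   components and all times share them. *)
have Tpair b t : t \in `[0, T] -> exists A B : 'cV[R]_m -> R,
    F b t = min_value A B /\ strongly_convex_pair del K Lam A B.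
  move=> tT; case: b.
    exists (coefA E nu mu sigma beta t), (coefB E nu beta t).
    by split => //; exact: (coef_pair regp tT).
  exists (coefA E nu (fun t => - mu t) sigma (fun t e => - beta t e) t),
    (coefB E nu (fun t e => - beta t e) t).
  by split => //; exact: (coef_pair regm tT).
have N2 : 0 < 2 * N by rewrite mulr_gt0.
have F_le0 b t p q : t \in `[0, T] -> 0 < p -> 0 < q -> F b t p q <= 0.
  move=> tT p0 q0; have [A [B [-> AB]]] := Tpair b t tT. exact: (min_value_le0 d0 AB p0 q0).
have F_ge b t p q : t \in `[0, T] -> 0 < p -> p <= q -> - (C * p) <= F b t p q.
  by move=> tT p0 pq; have [A [B [-> AB]]] := Tpair b t tT; exact: (min_value_ge d0 AB p0 pq).
have F_lip b t p q p' q' : t \in `[0, T] -> c <= p <= 1 -> c <= q <= 1 ->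
    c <= p' <= 1 -> c <= q' <= 1 ->
    `|F b t p q - F b t p' q'| <= N * (`|p - p'| + `|q - q'|).
  move=> tT pc qc pc' qc'; have [A [B [-> AB]]] := Tpair b t tT.
  apply: le_trans (min_value_lip d0 K0 AB c0 pc qc pc' qc') _.
  by rewrite ler_wpM2r ?addr_ge0// lerDl.
have F_bnd b t p q : t \in `[0, T] -> c <= p <= 1 -> c <= q <= 1 ->
    `|F b t p q| <= 2 * N.
  move=> tT pc qc; have [A [B [-> AB]]] := Tpair b t tT.
  apply: le_trans (min_value_bounded d0 K0 AB c0 pc qc) _.
  by rewrite ler_pM2l// lerDl.
have F_meas b (p q : R -> R) : measurable_fun setT p -> measurable_fun setT q ->
    (forall t, c <= p t <= 1) -> (forall t, c <= q t <= 1) ->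
    measurable_fun `[0, T]%classic (fun t => F b t (p t) (q t)).
  move=> mp mq pc qc.
  have pq0 t : `[0, T]%classic t -> 0 < p t /\ 0 < q t.
    by move=> _; have /andP[? _] := pc t; have /andP[? _] := qc t;
      split; exact: lt_le_trans c0 _.
  case: b.
    apply: (measurable_min_value d0 (coef_pair regp)) => //.
    - by move=> v; exact: measurable_coefA regp.
    - by move=> v; exact: measurable_coefB regp.
    - exact: measurable_funTS.
    - exact: measurable_funTS.
  apply: (measurable_min_value d0 (coef_pair regm)) => //.
  - by move=> v; exact: measurable_coefA regm.
  - by move=> v; exact: measurable_coefB regm.
  - exact: measurable_funTS.
  - exact: measurable_funTS.
have [X [solX Xc uniqX]] :=
  coupled_ode T0 C0 N0 N2 F_le0 F_ge F_lip F_bnd F_meas.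
exists (X true, X false).
have selX : sel (X true, X false) = X by apply/funext => -[].
split.
- by apply/solE; rewrite selX.
- move=> Q /solE /uniqX QX t tT.
  by split; [exact: (QX true t tT)|exact: (QX false t tT)].
- apply: (argmin_Hplus regp c0) => t tT.
  by split; [exact: (Xc true t tT)|exact: (Xc false t tT)].
(* In the sign-changed problem the weights trade places: [X false] comes first. *)
have [|vm [vmE vmb]] := @argmin_Hplus _ _ _ _ _ _ _ _ _ _ _ _ c (X false) (X true) regm c0.
  by move=> t tT; split; [exact: (Xc false t tT)|exact: (Xc true t tT)].
exists vm; split => // t tT; rewrite -vmE//.
by congr argmin; apply/funext => v; rewrite HminusE.
Qed.
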